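(* Fix $\varepsilon\in(0,1]$. Consider models of horizon $T$ satisfying the strong mixing assumption with $\boldsymbol{\epsilon}_T\ge\varepsilon$ (see context). For such a model and $s_{\mathrm{ref}},\tilde s_{\mathrm{ref}}\in\mathsf{X}^T$, let $(S_0,\tilde S_0)=(s_{\mathrm{ref}},\tilde s_{\mathrm{ref}})$ and $(S_k,\tilde S_k)\leftarrow\mathrm{CCBPF}(S_{k-1},\tilde S_{k-1},N)$ for $k\ge1$ (a Markov chain), and denote the coupling time $\tau=\inf\{k\ge1: S_k=\tilde S_k\}$. For any $\rho>0$ there exists $N_0=N_0(\varepsilon,\rho)<\infty$ such that for all $N\ge N_0$, for any family of such models and references, one for each horizon $T\ge1$, $$\lim_{T\to\infty}\mathbb{P}(\tau\ge\lceil\rho T\rceil)=0.\qquad(\ast)$$ More precisely, for any $\alpha,\beta\in(1,\infty)$ there exists $N_0=N_0(\varepsilon,\alpha,\beta)\in\mathbb{N}$ such that for all $N\ge N_0$, every such model of horizon $T$ and all $s_{\mathrm{ref}},\tilde s_{\mathrm{ref}}\in\mathsf{X}^T$, $$\mathbb{P}(\tau\ge n)\le\alpha^T\beta^{-n}\qquad\text{for all } n,T\in\mathbb{N}.$$ In particular, for any $\rho>\log(\alpha)/\log(\beta)$, $(\ast)$ holds (for these $N$).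
   Context: Model. $\mathsf{X}$ is a measurable space with a $\sigma$-finite measure written $\mathrm{d}x$. A model of horizon $T$ consists of a probability density $M_1$ on $\mathsf{X}$, Markov transition densities $M_t(x_{t-1},x_t)$ (densities in $x_t$), $t=2,\dots,T$, and measurable potentials $G_1:\mathsf{X}\to[0,\infty)$, $G_t:\mathsf{X}^2\to[0,\infty)$, $t=2,\dots,T$, such that $\gamma_T(x_{1:T})=M_1(x_1)G_1(x_1)\prod_{t=2}^T M_t(x_{t-1},x_t)G_t(x_{t-1},x_t)$ has $\int\gamma_T\in(0,\infty)$. Strong mixing assumption. $G_*(1)=\inf_x G_1(x)>0$, $G^*(1)=\sup_x G_1(x)<\infty$, and for all $t=2,\dots,T$: $M_*(t)=\inf_{x,y}M_t(x,y)>0$, $M^*(t)=\sup_{x,y}M_t(x,y)<\infty$, $G_*(t)=\inf_{x,y}G_t(x,y)>0$, $G^*(t)=\sup_{x,y}G_t(x,y)<\infty$. Set $$\boldsymbol{\epsilon}_T=\min_{t=1,\dots,T-1}\frac{G_*(t)M_*(t+1)G_*(t+1)}{G^*(t)M^*(t+1)G^*(t+1)},$$ with $\boldsymbol{\epsilon}_1=G_*(1)/G^*(1)$ when $T=1$. Coupled resampling $\mathrm{CRes}(\omega^{(1:N)},\tilde\omega^{(1:N)},n)$: let $w^{(i)}=\omega^{(i)}/\sum_j\omega^{(j)}$, $\tilde w^{(i)}=\tilde\omega^{(i)}/\sum_j\tilde\omega^{(j)}$, $p_c=\sum_j w^{(j)}\wedge\tilde w^{(j)}$, $w_c=(w\wedge\tilde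 w)/p_c$, $w_r=(w-w\wedge\tilde w)/(1-p_c)$, $\tilde w_r=(\tilde w-w\wedge\tilde w)/(1-p_c)$. Independently for $i=1,\dots,n$: with probability $p_c$ draw $I^{(i)}=\tilde I^{(i)}\sim w_c$; otherwise draw independently $I^{(i)}\sim w_r$, $\tilde I^{(i)}\sim\tilde w_r$. Output $(I^{(1:n)},\tilde I^{(1:n)})$. $\mathrm{CCBPF}(X^*_{1:T},\tilde X^*_{1:T},N)$, $N\ge2$: 1. $(X_{1:T}^{(1)},\tilde X_{1:T}^{(1)})=(X^*_{1:T},\tilde X^*_{1:T})$; for $i=2,\dots,N$ independently $X_1^{(i)}=\tilde X_1^{(i)}\sim M_1$; $\omega_1^{(i)}=G_1(X_1^{(i)})$, $\tilde\omega_1^{(i)}=G_1(\tilde X_1^{(i)})$ for $i=1,\dots,N$. 2. For $t=2,\dots,T$: $I_t^{(1)}=\tilde I_t^{(1)}=1$; $(I_t^{(2:N)},\tilde I_t^{(2:N)})\leftarrow\mathrm{CRes}(\omega_{t-1}^{(1:N)},\tilde\omega_{t-1}^{(1:N)},N-1)$; conditionally independently over $i=2,\dots,N$: if $X_{t-1}^{(I_t^{(i)})}=\tilde X_{t-1}^{(\tilde I_t^{(i)})}$ draw $X_t^{(i)}=\tilde X_t^{(i)}\sim M_t(X_{t-1}^{(I_t^{(i)})},\cdot)$, otherwise draw $(X_t^{(i)},\tilde X_t^{(i)})$ from any (fixed, measurable) coupling of $M_t(X_{t-1}^{(I_t^{(i)})},\cdot)$ and $M_t(\tilde X_{t-1}^{(\tilde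 I_t^{(i)})},\cdot)$; set $\omega_t^{(i)}=G_t(X_{t-1}^{(I_t^{(i)})},X_t^{(i)})$, $\tilde\omega_t^{(i)}=G_t(\tilde X_{t-1}^{(\tilde I_t^{(i)})},\tilde X_t^{(i)})$ for $i=1,\dots,N$. 3. $(J_T,\tilde J_T)\leftarrow\mathrm{CRes}(\omega_T^{(1:N)},\tilde\omega_T^{(1:N)},1)$. For $t=T-1,\dots,1$: $b_t^{(i)}=\omega_t^{(i)}M_{t+1}(X_t^{(i)},X_{t+1}^{(J_{t+1})})G_{t+1}(X_t^{(i)},X_{t+1}^{(J_{t+1})})$, $\tilde b_t^{(i)}=\tilde\omega_t^{(i)}M_{t+1}(\tilde X_t^{(i)},\tilde X_{t+1}^{(\tilde J_{t+1})})G_{t+1}(\tilde X_t^{(i)},\tilde X_{t+1}^{(\tilde J_{t+1})})$, $(J_t,\tilde J_t)\leftarrow\mathrm{CRes}(b_t^{(1:N)},\tilde b_t^{(1:N)},1)$. 4. Output $(X_{1:T}^{(J_{1:T})},\tilde X_{1:T}^{(\tilde J_{1:T})})$, where $X_{1:T}^{(J_{1:T})}=(X_1^{(J_1)},\dots,X_T^{(J_T)})$.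
   Formalization: The bound P(τ≥n) ≤ α^T β^{-n} is stated for all n≠1: at n=1 it fails whenever α^T<β, since τ≥1 always (and it is trivial when α^T≥β); the diagonal of X² is assumed measurable so that τ is well defined. *)

(* Defs.v *)
From HB Require Import structures.
From mathcomp Require Import all_boot all_order all_algebra.
From mathcomp Require Import all_classical all_reals all_analysis.

Set Implicit Arguments.
Unset Strict Implicit.
Unset Printing Implicit Defensive.

Import Order.TTheory GRing.Theory Num.Theory.
Import numFieldNormedType.Exports.

Local Open Scope classical_set_scope.
Local Open Scope ring_scope.
Local Open Scope ereal_scope.

Section randomized_algorithms.
Context {R : realType}.

(* The law of the output of a randomized algorithm, given as its expectation
   operator f |-> E[f(output)] on functions f >= 0.  Sequential composition is
   then the usual composition of a law with a transition kernel,
   E[f] = \int m(dz) \int k(z, dz') f(z').  Under the measurability conditions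
   of [is_model] and [is_coupling], and for a measurable diagonal, every
   integrand met below is measurable. *)
Definition law (Z : Type) := (Z -> \bar R) -> \bar R.

Definition ret (Z : Type) (z : Z) : law Z := fun f => f z.

Definition bind (Y Z : Type) (m : law Y) (k : Y -> law Z) : law Z :=
  fun f => m (fun y => k y f).

Local Notation "x <~ m ; k" := (bind m (fun x => k))
  (at level 100, m at level 99, k at level 200, right associativity).

Definition draw d (Z : measurableType d) (mu : {measure set Z -> \bar R}) :
  law Z := fun f => \int[mu]_z f z.

Definition draw_density d (Z : measurableType d)
    (mu : {measure set Z -> \bar R}) (p : Z -> R) : law Z :=
  fun f => \int[mu]_z ((p z)%:E * f z).

Definition categorical (N : nat) (w : 'I_N -> R) : law 'I_N :=
  fun f => \sum_(i < N) (w i)%:E * f i.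

Definition mix (Z : Type) (p : R) (a b : law Z) : law Z :=
  fun f => p%:E * a f + (1 - p)%:E * b f.

Fixpoint indep (Z : Type) (n : nat) : ('I_n -> law Z) -> law (n.-tuple Z) :=
  match n with
  | 0%N => fun _ => ret [tuple]
  | m.+1 => fun l =>
      z <~ l ord0; zs <~ indep (fun i => l (lift ord0 i));
      ret [tuple of z :: zs]
  end.

(* The weight vectors omega, omega~ are stored as one tuple of pairs.  If
   pc = 0 or pc = 1, the quotients by zero only occur in the branch that has
   probability zero. *)
Definition cres1 (N : nat) (om : N.-tuple (R * R)) : law ('I_N * 'I_N) :=
  let w  (i : 'I_N) : R := ((tnth om i).1 / \sum_(j < N) (tnth om j).1)%R in
  let w' (i : 'I_N) : R := ((tnth om i).2 / \sum_(j < N) (tnth om j).2)%R in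
  let v  (i : 'I_N) : R := Num.min (w i) (w' i) in
  let pc : R := (\sum_(j < N) v j)%R in
  mix pc
    (I <~ categorical (fun i => v i / pc)%R; ret (I, I))
    (I <~ categorical (fun i => (w i - v i) / (1 - pc))%R;
     I' <~ categorical (fun i => (w' i - v i) / (1 - pc))%R;
     ret (I, I')).

Definition cres (N : nat) (om : N.-tuple (R * R)) (n : nat) :
    law (n.-tuple ('I_N * 'I_N)) :=
  indep (fun _ => cres1 om).

End randomized_algorithms.

Arguments cres {R N} om n.

Local Notation "x <~ m ; k" := (bind m (fun x => k))
  (at level 100, m at level 99, k at level 200, right associativity).

(* Times are numbered from 1: [Mt t] and [Gt t] matter for t >= 2 only. *)
Record model (R : realType) (X : Type) := Model {
  M1 : X -> R ;
  Mt : nat -> X -> X -> R ;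
  G1 : X -> R ;
  Gt : nat -> X -> X -> R }.

Definition couplings (R : realType) d (X : measurableType d) :=
  nat -> R.-pker (X * X)%type ~> (X * X)%type.

Section model.
Context {R : realType} d (X : measurableType d).
Variable mu : {sigma_finite_measure set X -> \bar R}.

Definition gamma (m : model R X) (T : nat) (x : T.-tuple X) : R :=
  let x_ t := nth point x t.-1 in
  (M1 m (x_ 1%N) * G1 m (x_ 1%N) *
   \prod_(2 <= t < T.+1) (Mt m t (x_ t.-1) (x_ t) * Gt m t (x_ t.-1) (x_ t)))%R.

(* Iterated integral of f over X^n with respect to dx_1 ... dx_n. *)
Fixpoint path_integral (n : nat) : (n.-tuple X -> \bar R) -> \bar R :=
  match n with
  | 0%N => fun f => f [tuple]
  | k.+1 => fun f =>
      \int[mu]_x path_integral (fun p : k.-tuple X => f [tuple of x :: p])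
  end.

Record is_model (T : nat) (m : model R X) : Prop := IsModel {
  M1_measurable : measurable_fun setT (M1 m) ;
  M1_ge0 : forall x, (0 <= M1 m x)%R ;
  M1_density : \int[mu]_x (M1 m x)%:E = 1 ;
  Mt_measurable : forall t, (2 <= t <= T)%N ->
    measurable_fun setT (fun z : X * X => Mt m t z.1 z.2) ;
  Mt_ge0 : forall t, (2 <= t <= T)%N -> forall x y, (0 <= Mt m t x y)%R ;
  Mt_density : forall t, (2 <= t <= T)%N ->
    forall x, \int[mu]_y (Mt m t x y)%:E = 1 ;
  G1_measurable : measurable_fun setT (G1 m) ;
  G1_ge0 : forall x, (0 <= G1 m x)%R ;
  Gt_measurable : forall t, (2 <= t <= T)%N ->
    measurable_fun setT (fun z : X * X => Gt m t z.1 z.2) ;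
  Gt_ge0 : forall t, (2 <= t <= T)%N -> forall x y, (0 <= Gt m t x y)%R ;
  gamma_integral :
    0 < path_integral (fun x : T.-tuple X => (gamma m x)%:E) < +oo }.

(* Extended-real infima and suprema: the real-valued [sup] is 0 on unbounded
   sets. *)
Definition infE (Y : Type) (f : Y -> R) : \bar R :=
  ereal_inf (range (fun y => (f y)%:E)).
Definition supE (Y : Type) (f : Y -> R) : \bar R :=
  ereal_sup (range (fun y => (f y)%:E)).

Definition Mlow (m : model R X) t := infE (fun z : X * X => Mt m t z.1 z.2).
Definition Mup (m : model R X) t := supE (fun z : X * X => Mt m t z.1 z.2).
Definition Glow (m : model R X) (t : nat) :=
  if t == 1%N then infE (G1 m) else infE (fun z : X * X => Gt m t z.1 z.2).
Definition Gup (m : model R X) (t : nat) :=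
  if t == 1%N then supE (G1 m) else supE (fun z : X * X => Gt m t z.1 z.2).

Definition strong_mixing (T : nat) (m : model R X) : Prop :=
  [/\ forall t, (1 <= t <= T)%N -> 0 < Glow m t /\ Gup m t < +oo
    & forall t, (2 <= t <= T)%N -> 0 < Mlow m t /\ Mup m t < +oo].

Definition mixing_ratio (m : model R X) (t : nat) : R :=
  ((fine (Glow m t) * fine (Mlow m t.+1) * fine (Glow m t.+1)) /
   (fine (Gup m t) * fine (Mup m t.+1) * fine (Gup m t.+1)))%R.

Definition mixing_const (T : nat) (m : model R X) : R :=
  if T == 1%N then (fine (Glow m 1) / fine (Gup m 1))%R
  else \big[Num.min/mixing_ratio m 1]_(2 <= t < T) mixing_ratio m t.


(* Nothing is required on the diagonal, where the algorithm does not use the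
   kernel. *)
Definition is_coupling (T : nat) (m : model R X) (C : couplings R X) : Prop :=
  forall t, (2 <= t <= T)%N -> forall x y : X, x <> y ->
  forall A : set X, measurable A ->
    C t (x, y) (fst @^-1` A) = \int[mu]_(z in A) (Mt m t x z)%:E /\
    C t (x, y) (snd @^-1` A) = \int[mu]_(z in A) (Mt m t y z)%:E.

End model.

Section ccbpf.
Context {R : realType} d (X : measurableType d).
Variables (mu : {sigma_finite_measure set X -> \bar R}).
Variables (m : model R X) (C : couplings R X).

(* There are N = n.+1 particles, numbered from 0, so that the particle with
   index [ord0] is the reference.  The pairs of particles (X_t^(i), X~_t^(i))
   and of weights (omega_t^(i), omega~_t^(i)) are the entries of one tuple
   each. *)
Variable n : nat.
Let particles := (n.+1.-tuple (X * X))%type.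
Let weights := (n.+1.-tuple (R * R))%type.

Definition coupled_init : @law R (X * X)%type :=
  x <~ draw_density mu (M1 m); ret (x, x).

Definition coupled_move (t : nat) (x y : X) : @law R (X * X)%type :=
  if x == y then z <~ draw_density mu (Mt m t x); ret (z, z)
  else draw (C t (x, y)).

Definition init_weights (Z : particles) : weights :=
  [tuple (G1 m (tnth Z i).1, G1 m (tnth Z i).2) | i < n.+1].

Definition forward_init (r r' : X) : @law R (particles * weights)%type :=
  Zs <~ indep (fun _ : 'I_n => coupled_init);
  let Z : particles := [tuple of (r, r') :: Zs] in
  ret (Z, init_weights Z).

Definition move_weights (t : nat) (parent : 'I_n.+1 -> X * X) (Z : particles) :
    weights :=
  [tuple (Gt m t (parent i).1 (tnth Z i).1, Gt m t (parent i).2 (tnth Z i).2)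
   | i < n.+1].

(* From time t.-1, with particles Z and weights om, to time t, where the
   reference states are r and r'. *)
Definition forward_step (t : nat) (r r' : X) (Z : particles) (om : weights) :
    @law R (particles * weights)%type :=
  Is <~ cres om n;
  let I : n.+1.-tuple ('I_n.+1 * 'I_n.+1) := [tuple of (ord0, ord0) :: Is] in
  let parent i := ((tnth Z (tnth I i).1).1, (tnth Z (tnth I i).2).2) in
  Zs <~ indep (fun i : 'I_n =>
          coupled_move t (parent (lift ord0 i)).1 (parent (lift ord0 i)).2);
  let Z' : particles := [tuple of (r, r') :: Zs] in
  ret (Z', move_weights t parent Z').

(* y and y' are the states selected at time t.+1. *)
Definition backward_weights (t : nat) (Z : particles) (om : weights)
    (y y' : X) : weights :=
  [tuple (((tnth om i).1 * Mt m t.+1 (tnth Z i).1 y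
             * Gt m t.+1 (tnth Z i).1 y)%R,
          ((tnth om i).2 * Mt m t.+1 (tnth Z i).2 y'
             * Gt m t.+1 (tnth Z i).2 y')%R) | i < n.+1].

(* Starts from the particles Z and weights om of time t, with horizon
   T = t + k and the references (r, r') at the times t.+1, ..., T still to be
   used; returns the pair of selected paths (x_t, ..., x_T).  The forward steps
   up to T all take place before the innermost draw of (J_T, J~_T), and the
   indices J_(T-1), ..., J_t are drawn as the recursive calls return. *)
Fixpoint forward_backward (k t : nat) :
    k.-tuple X * k.-tuple X -> particles -> weights ->
    @law R (k.+1.-tuple X * k.+1.-tuple X)%type :=
  match k with
  | 0%N => fun _ Z om =>
      J <~ cres1 om;
      ret ([tuple (tnth Z J.1).1], [tuple (tnth Z J.2).2])
  | k'.+1 => fun r Z om =>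
      Zom <~ forward_step t.+1 (thead r.1) (thead r.2) Z om;
      p <~ forward_backward t.+1
             ([tuple of behead r.1], [tuple of behead r.2]) Zom.1 Zom.2;
      J <~ cres1 (backward_weights t Z om (thead p.1) (thead p.2));
      ret ([tuple of (tnth Z J.1).1 :: p.1], [tuple of (tnth Z J.2).2 :: p.2])
  end.

Definition ccbpf_steps (T : nat) :
    T.-tuple X * T.-tuple X -> @law R (T.-tuple X * T.-tuple X)%type :=
  match T with
  | 0%N => fun s => ret s
  | k.+1 => fun s =>
      Zom <~ forward_init (thead s.1) (thead s.2);
      forward_backward 1 ([tuple of behead s.1], [tuple of behead s.2])
        Zom.1 Zom.2
  end.

End ccbpf.

(* CCBPF with N >= 2 particles; the horizon is the length of the paths, and
   only T >= 1 is meaningful. *)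
Definition ccbpf (R : realType) d (X : measurableType d)
    (mu : {sigma_finite_measure set X -> \bar R}) (m : model R X)
    (C : couplings R X) (N T : nat) (s : T.-tuple X * T.-tuple X) :
    @law R (T.-tuple X * T.-tuple X)%type :=
  ccbpf_steps mu m C N.-1 s.

(* S is a time-homogeneous Markov chain (with respect to its own filtration)
   started at s0, whose transition probabilities are z, B |-> K z (\1_B). *)
Record is_markov_chain (R : realType) dW (W : measurableType dW)
    (P : probability W R) dE (E : measurableType dE)
    (K : E -> @law R E) (s0 : E) (S : nat -> W -> E) : Prop := IsMarkovChain {
  chain_measurable : forall k, measurable_fun setT (S k) ;
  chain_start : forall w, S 0%N w = s0 ;
  chain_transition : forall (k : nat) (A : set (k.+1.-tuple E)) (B : set E),
    measurable A -> measurable B ->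
    let hist := [set w | A [tuple S i w | i < k.+1]] in
    P (hist `&` (S k.+1 @^-1` B)) =
    \int[P]_(w in hist) K (S k w) (fun z => (\1_B z)%:E) }.

Definition coupling_time (R : realType) (W E : Type) (S : nat -> W -> E * E)
    (w : W) : \bar R :=
  ereal_inf [set (k%:R : R)%:E | k in
               [set k : nat | (1 <= k)%N /\ (S k w).1 = (S k w).2]].

(* Equality of states has to be an event for the branching of the algorithm and
   for the coupling time to make sense. *)
Definition measurable_diagonal d (X : measurableType d) : Prop :=
  measurable [set z : X * X | z.1 = z.2].

Definition admissible (R : realType) d (X : measurableType d)
    (mu : {sigma_finite_measure set X -> \bar R}) (eps : R) (T : nat)
    (m : model R X) (C : couplings R X) : Prop :=
  [/\ is_model mu T m, strong_mixing T m, (eps <= mixing_const T m)%R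
    & is_coupling mu T m C].

(* The families are indexed by the horizon T; their members at T = 0 are
   unconstrained and irrelevant. *)
Definition couples_in_linear_time (R : realType) (eps : R) (N : nat) (rho : R) :
    Prop :=
  forall d (X : measurableType d) (mu : {sigma_finite_measure set X -> \bar R})
    (m : nat -> model R X) (C : nat -> couplings R X)
    (s : forall T : nat, T.-tuple X * T.-tuple X)
    (dW : nat -> measure_display) (W : forall T, measurableType (dW T))
    (P : forall T, probability (W T) R)
    (S : forall T : nat, nat -> W T -> T.-tuple X * T.-tuple X),
  measurable_diagonal X ->
  (forall T, (1 <= T)%N -> admissible mu eps T (m T) (C T)) ->
  (forall T, (1 <= T)%N ->
     is_markov_chain (P T) (@ccbpf R d X mu (m T) (C T) N T) (s T) (S T)) ->
  P T [set w | ((Num.ceil (rho * T%:R))%:~R : R)%:E <= coupling_time R (S T) w]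
    @[T --> \oo] --> 0.

(* Main.v *)
(** Let [b] be the number of initial coordinates on which the two references
    agree, and let [D = T - b].  All pairs of particles up to time [b] coincide;
    afterwards each resampling multiplies the expected number of pairs that
    differ by at most [1/eps] and adds the reference, so that at time [b + j]
    this expectation is bounded independently of [N].  In the backward pass,
    strong mixing couples the indices with probability at least about [eps] at
    each step, and once coupled they separate only with a probability of order
    [1/N] at times close to [b], and never at times [<= b].  Hence, for [al] close
    to [1], [l] large and then [N] large, the expectation of [al^D] (with value
    [0] if the paths agree) is multiplied by a factor as small as desired at each
    iteration, and Markov's inequality bounds the tail of the coupling time.

    Laws are only known to be monotone and superadditive, since the integrands
    are not shown to be measurable.  Upper bounds are therefore always obtained
    by bounding an integrand pointwise by a constant or by a function of finitely
    many indices, and only the inequality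
    [\sum_j c_j E[f_j] <= E[\sum_j c_j f_j]] is needed in the other direction. *)
Require Import Defs.
From mathcomp Require Import all_boot all_order all_algebra.
From mathcomp Require Import all_classical all_reals all_analysis.
From mathcomp Require Import measurable_realfun.
From mathcomp Require Import ring lra zify.
Import Order.TTheory GRing.Theory Num.Theory.
Import numFieldNormedType.Exports.
Local Open Scope classical_set_scope.
Local Open Scope ring_scope.
Local Open Scope ereal_scope.

Set Implicit Arguments.
Unset Strict Implicit.
Unset Printing Implicit Defensive.

(** * Superadditive laws *)

Section lower_integral.
Context d (T : measurableType d) (R : realType).
Variable mu : {measure set T -> \bar R}.
Implicit Types (D : set T) (f g : T -> \bar R).

Import HBNNSimple.

(* The library integral of a nonnegative function is the supremum of the
   integrals of the simple functions below it, so that it is monotone and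
   superadditive on nonmeasurable functions as well. *)
Lemma integral_mono D f g : (forall x, D x -> 0 <= f x) ->
  (forall x, D x -> f x <= g x) ->
  \int[mu]_(x in D) f x <= \int[mu]_(x in D) g x.
Proof.
move=> f0 fg; have g0 x : D x -> 0 <= g x.
  by move=> Dx; exact: le_trans (f0 _ Dx) (fg _ Dx).
rewrite !ge0_integralE//; apply: ereal_sup_le => _ [h hf <-]; exists h => //= x.
apply: le_trans (hf x) _; rewrite /patch; case: ifPn => //.
by rewrite inE => Dx; exact: fg.
Qed.

(** If simple functions [h1] and [h2] lie below [f] and [g], then [c h1 + h2] is a simple function
    below [c f + g], and simple functions integrate additively; it remains to take suprema. *)
Lemma integral_superlinearT (c : R) f g : (0 <= c)%R ->
  (forall x, 0 <= f x) -> (forall x, 0 <= g x) ->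
  c%:E * \int[mu]_x f x + \int[mu]_x g x <= \int[mu]_x (c%:E * f x + g x).
Proof.
move=> c0 f0 g0.
have cfg0 x : 0 <= c%:E * f x + g x by rewrite adde_ge0// mule_ge0.
set X := \int[mu]_x (_ + _).
have [->|Xy] := eqVneq X +oo; first exact: leey.
have X0 : 0 <= X by exact: integral_ge0.
have Xfin : X \is a fin_num by rewrite ge0_fin_numE// ltey.
have key (h1 h2 : {nnsfun T >-> R}) : (forall x, (h1 x)%:E <= f x) ->
    (forall x, (h2 x)%:E <= g x) ->
    c%:E * sintegral mu h1 + sintegral mu h2 <= X.
  move=> h1f h2g; rewrite -sintegralrM.
  rewrite -(sintegralD mu (scale_nnsfun h1 c0) h2).
  rewrite /X ge0_integralTE//; apply: ereal_sup_ubound.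
  exists (add_nnsfun (scale_nnsfun h1 c0) h2) => //= x.
  by rewrite EFinD EFinM leeD// lee_wpmul2l// lee_fin.
have gX : \int[mu]_x g x <= X.
  by apply: integral_mono => // x _; rewrite leeDr// mule_ge0.
have gfin : \int[mu]_x g x \is a fin_num.
  rewrite ge0_fin_numE; last exact: integral_ge0.
  by apply: le_lt_trans gX _; rewrite -ge0_fin_numE.
have [->|cn0] := eqVneq c 0%R; first by rewrite mul0e add0e.
have {cn0}c1 : (0 < c)%R by rewrite lt_neqAle eq_sym cn0.
(* The suprema over [h1] and [h2] are taken one after the other, with the remaining term moved
   across the inequality. This uses that all terms are finite and that [c] is positive. *)
rewrite -leeBrDr// muleC -lee_pdivlMr//.
rewrite [leLHS]ge0_integralTE//; apply: ge_ereal_sup => _ [h1 h1f <-].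
rewrite lee_pdivlMr// leeBrDr// addeC muleC.
have c1fin : c%:E * sintegral mu h1 \is a fin_num.
  rewrite ge0_fin_numE ?mule_ge0 ?sintegral_ge0//.
  apply: le_lt_trans (_ : X < +oo); last by rewrite -ge0_fin_numE.
  have := key h1 nnsfun0 h1f (fun x => g0 x).
  by rewrite sintegral0 adde0.
rewrite -leeBrDr// [leLHS]ge0_integralTE//; apply: ge_ereal_sup => _ [h2 h2g <-].
by rewrite leeBrDr// addeC; exact: key.
Qed.

Lemma integral_superlinear D (c : R) f g : (0 <= c)%R ->
  (forall x, D x -> 0 <= f x) -> (forall x, D x -> 0 <= g x) ->
  c%:E * \int[mu]_(x in D) f x + \int[mu]_(x in D) g x <=
  \int[mu]_(x in D) (c%:E * f x + g x).
Proof.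
move=> c0 f0 g0; rewrite !(integral_mkcond D).
apply: le_trans (integral_superlinearT c0 _ _) _.
- by move=> x; rewrite erestrict_ge0.
- by move=> x; rewrite erestrict_ge0.
apply: integral_mono => x _.
  by rewrite adde_ge0// ?mule_ge0// ?erestrict_ge0.
by rewrite /patch; case: ifP => // _; rewrite mule0 adde0.
Qed.

End lower_integral.

Record superlinear_law (R : realType) (Z : Type) (l : @law R Z) := {
  law_ge0 : forall f, (forall z, 0 <= f z) -> 0 <= l f ;
  law_mono : forall f g, (forall z, 0 <= f z) -> (forall z, f z <= g z) ->
    l f <= l g ;
  law_superlinear : forall (c : R) f g, (0 <= c)%R ->
    (forall z, 0 <= f z) -> (forall z, 0 <= g z) ->
    c%:E * l f + l g <= l (fun z => c%:E * f z + g z) }.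

Section superlinear_laws.
Context {R : realType}.

Lemma law_superlinear_sum (Z : Type) (l : @law R Z) n (c : 'I_n -> R)
    (f : 'I_n -> Z -> \bar R) : superlinear_law l ->
  (forall i, (0 <= c i)%R) -> (forall i z, 0 <= f i z) ->
  \sum_(i < n) (c i)%:E * l (f i) <= l (fun z => \sum_(i < n) (c i)%:E * f i z).
Proof.
move=> sl; elim: n c f => [|n IH] c f c0 f0.
  by rewrite big_ord0; apply: (law_ge0 sl) => z; rewrite big_ord0.
rewrite big_ord_recl; apply: le_trans (_ : (c ord0)%:E * l (f ord0) +
    l (fun z => \sum_(i < n) (c (lift ord0 i))%:E * f (lift ord0 i) z) <= _).
  by rewrite leeD2l// IH.
have s0 z : 0 <= \sum_(i < n) (c (lift ord0 i))%:E * f (lift ord0 i) z.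
  by apply: sume_ge0 => i _; rewrite mule_ge0 ?lee_fin.
apply: le_trans (law_superlinear sl (c0 _) (f0 _) s0) _.
apply: (law_mono sl) => z; first by rewrite adde_ge0// mule_ge0 ?lee_fin.
by rewrite big_ord_recl.
Qed.

Lemma superlinear_ret (Z : Type) (z : Z) : superlinear_law (@ret R Z z).
Proof. by split; rewrite /ret. Qed.

Lemma superlinear_bind (Y Z : Type) (m : @law R Y) (k : Y -> @law R Z) :
  superlinear_law m -> (forall y, superlinear_law (k y)) ->
  superlinear_law (bind m k).
Proof.
move=> slm slk; split; rewrite /bind.
- by move=> f f0; apply: (law_ge0 slm) => y; exact: (law_ge0 (slk y)).
- move=> f g f0 fg; apply: (law_mono slm) => y.
    exact: (law_ge0 (slk y)).
  exact: (law_mono (slk y)).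
- move=> c f g c0 f0 g0; apply: le_trans (law_superlinear slm c0 _ _) _.
  + by move=> y; exact: (law_ge0 (slk y)).
  + by move=> y; exact: (law_ge0 (slk y)).
  apply: (law_mono slm) => y; last exact: (law_superlinear (slk y)).
  by rewrite adde_ge0// ?mule_ge0// (law_ge0 (slk y)).
Qed.

Lemma superlinear_integral d (Z : measurableType d)
    (mu : {measure set Z -> \bar R}) (D : set Z) :
  superlinear_law (fun f : Z -> \bar R => \int[mu]_(z in D) f z).
Proof.
split.
- by move=> f f0; exact: integral_ge0.
- by move=> f g f0 fg; exact: integral_mono.
- by move=> c f g c0 f0 g0; exact: integral_superlinear.
Qed.

Lemma superlinear_draw d (Z : measurableType d) (mu : {measure set Z -> \bar R}) :
  superlinear_law (draw mu).
Proof. exact: superlinear_integral. Qed.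

Lemma superlinear_draw_density d (Z : measurableType d)
    (mu : {measure set Z -> \bar R}) (p : Z -> R) :
  (forall z, 0 <= p z)%R -> superlinear_law (draw_density mu p).
Proof.
move=> p0; split; rewrite /draw_density.
- by move=> f f0; apply: integral_ge0 => z _; rewrite mule_ge0 ?lee_fin.
- move=> f g f0 fg; apply: integral_mono => z _; first by rewrite mule_ge0 ?lee_fin.
  by rewrite lee_wpmul2l// lee_fin.
- move=> c f g c0 f0 g0; apply: le_trans (integral_superlinear _ c0 _ _) _.
  + by move=> z _; rewrite mule_ge0 ?lee_fin.
  + by move=> z _; rewrite mule_ge0 ?lee_fin.
  apply: integral_mono => z _.
    by rewrite adde_ge0// !mule_ge0 ?lee_fin.
  by rewrite ge0_muleDr ?mule_ge0// muleCA.
Qed.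

Lemma superlinear_categorical N (w : 'I_N -> R) :
  (forall i, 0 <= w i)%R -> superlinear_law (categorical w).
Proof.
move=> w0; split; rewrite /categorical.
- by move=> f f0; apply: sume_ge0 => i _; rewrite mule_ge0 ?lee_fin.
- by move=> f g f0 fg; apply: lee_sum => i _; rewrite lee_wpmul2l// lee_fin.
- move=> c f g c0 f0 g0; rewrite ge0_sume_distrr; last first.
    by move=> i _; rewrite mule_ge0 ?lee_fin.
  rewrite -big_split/=; apply: lee_sum => i _.
  by rewrite ge0_muleDr ?mule_ge0// muleCA.
Qed.

Lemma superlinear_mix (Z : Type) (p : R) (a b : @law R Z) : (0 <= p <= 1)%R ->
  superlinear_law a -> superlinear_law b -> superlinear_law (mix p a b).
Proof.
move=> /andP[p0 p1] sa sb; have q0 : (0 <= 1 - p)%R by rewrite subr_ge0.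
split; rewrite /mix.
- move=> f f0; rewrite adde_ge0// mule_ge0//.
  + exact: (law_ge0 sa).
  + exact: (law_ge0 sb).
- move=> f g f0 fg; rewrite leeD// lee_wpmul2l//.
  + exact: (law_mono sa).
  + exact: (law_mono sb).
- move=> c f g c0 f0 g0.
  have a0 := law_ge0 sa f0; have b0 := law_ge0 sb f0.
  have a0' := law_ge0 sa g0; have b0' := law_ge0 sb g0.
  rewrite ge0_muleDr ?mule_ge0// addeACA leeD//.
  + rewrite muleCA -ge0_muleDr ?mule_ge0// lee_wpmul2l//.
    exact: (law_superlinear sa).
  + rewrite muleCA -ge0_muleDr ?mule_ge0// lee_wpmul2l//.
    exact: (law_superlinear sb).
Qed.

Lemma superlinear_indep (Z : Type) n (l : 'I_n -> @law R Z) :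
  (forall i, superlinear_law (l i)) -> superlinear_law (indep l).
Proof.
elim: n l => [|n IH] l sl /=; first exact: superlinear_ret.
apply: superlinear_bind => // z; apply: superlinear_bind => [|zs]; first exact: IH.
exact: superlinear_ret.
Qed.

End superlinear_laws.

(** * Coupled resampling *)

Section finite_laws.
Context {R : realType}.

(** Concentration on [A] together with total mass at most 1, phrased through constant upper bounds
    so that neither [A] nor [f] has to be measurable. For [A = setT] only the bound on the mass
    remains. *)
Definition supported (Z : Type) (l : @law R Z) (A : set Z) : Prop :=
  forall f (a : R), (0 <= a)%R -> (forall z, 0 <= f z) ->
    (forall z, A z -> f z <= a%:E) -> l f <= a%:E.

Lemma supported_indep (Z : Type) n (l : 'I_n -> @law R Z) (A : 'I_n -> set Z) :
  (forall i, superlinear_law (l i)) -> (forall i, supported (l i) (A i)) ->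
  supported (indep l) [set zs | forall i, A i (tnth zs i)].
Proof.
elim: n l A => [|n IH] l A sl sA f a a0 f0 fa /=.
  by apply: fa => -[].
apply: (sA ord0) => // [z|z Az].
  exact: (law_ge0 (superlinear_indep (fun i => sl (lift ord0 i))) (fun zs => f0 _)).
apply: (IH (fun i => l (lift ord0 i)) (fun i => A (lift ord0 i)) _ _ _ a a0).
- by move=> i; exact: sl.
- by move=> i; exact: sA.
- by move=> zs; exact: f0.
move=> zs Azs.
apply: (fa [tuple of z :: zs]) => i; case: (unliftP ord0 i) => [j ->|->].
  by rewrite tnthS.
by rewrite tnth0.
Qed.

Lemma indep_le_sum (Z : Type) (l : @law R Z) (bad : pred Z) (q : R) :
  (forall f (a b : R), (0 <= b)%R -> (forall z, f z <= (a + b * (bad z)%:R)%:E) ->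
     l f <= (a + b * q)%:E) ->
  forall n (f : n.-tuple Z -> \bar R) (a b : R), (0 <= b)%R ->
  (forall zs, f zs <= (a + b * (\sum_(i < n) bad (tnth zs i))%:R)%:E) ->
  indep (fun _ : 'I_n => l) f <= (a + b * (n%:R * q))%:E.
Proof.
move=> lq; elim=> [|n IH] f a b b0 fab /=.
  by rewrite mul0r mulr0 addr0; have := fab [tuple]; rewrite big_ord0 mulr0 addr0.
have -> : (a + b * (n.+1%:R * q) = (a + b * (n%:R * q)) + b * q)%R.
  by rewrite -natr1; ring.
apply: lq => // z; rewrite addrAC; apply: IH => // zs.
apply: le_trans (fab [tuple of z :: zs]) _.
rewrite lee_fin big_ord_recl tnth0 natrD mulrDr addrA.
by under eq_bigr do rewrite tnthS.
Qed.

Lemma categorical_le N (w : 'I_N -> R) (f : 'I_N -> \bar R) (g : 'I_N -> R) :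
  (forall i, 0 <= w i)%R -> (forall i, f i <= (g i)%:E) ->
  categorical w f <= (\sum_(i < N) w i * g i)%:E.
Proof.
move=> w0 fg; rewrite /categorical -sumEFin; apply: lee_sum => i _.
by rewrite EFinM lee_wpmul2l// lee_fin.
Qed.

Definition overlap N (om : N.-tuple (R * R)) (i : 'I_N) : R :=
  Num.min ((tnth om i).1 / \sum_(j < N) (tnth om j).1)%R
          ((tnth om i).2 / \sum_(j < N) (tnth om j).2)%R.

Definition nonneg_weights N (om : N.-tuple (R * R)) : Prop :=
  forall i, (0 <= (tnth om i).1)%R /\ (0 <= (tnth om i).2)%R.

Lemma sum_normalized_le1 N (a : 'I_N -> R) :
  (\sum_(i < N) a i / \sum_(j < N) a j <= 1)%R.
Proof.
rewrite -mulr_suml; set S := (\sum_i _)%R.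
(* If the total is zero, the normalized sum is [0 / 0 = 0], which is why only an inequality
   holds. *)
by have [->|S0] := eqVneq S 0%R; [rewrite mul0r|rewrite divff].
Qed.

Lemma overlap_ge0 N (om : N.-tuple (R * R)) i : nonneg_weights om ->
  (0 <= overlap om i)%R.
Proof.
move=> om0; rewrite /overlap le_min !divr_ge0//.
- by case: (om0 i).
- by apply: sumr_ge0 => j _; case: (om0 j).
- by case: (om0 i).
- by apply: sumr_ge0 => j _; case: (om0 j).
Qed.

Lemma sum_overlap_le1 N (om : N.-tuple (R * R)) : (\sum_i overlap om i <= 1)%R.
Proof.
apply: le_trans (sum_normalized_le1 (fun i => (tnth om i).1)).
by apply: ler_sum => i _; rewrite /overlap ge_min lexx.
Qed.

Lemma superlinear_cres1 N (om : N.-tuple (R * R)) : nonneg_weights om ->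
  superlinear_law (cres1 om).
Proof.
move=> om0; have v0 i := overlap_ge0 i om0.
have p1 := sum_overlap_le1 om.
have p0 : (0 <= \sum_i overlap om i)%R by apply: sumr_ge0 => i _; exact: v0.
have q0 : (0 <= 1 - \sum_i overlap om i)%R by rewrite subr_ge0.
apply: superlinear_mix; first by rewrite p0.
  apply: superlinear_bind => [|i]; last exact: superlinear_ret.
  apply: superlinear_categorical => i.
  by apply: divr_ge0; [exact: v0|exact: p0].
apply: superlinear_bind => [|i].
  apply: superlinear_categorical => i; apply: divr_ge0; last exact: q0.
  by rewrite subr_ge0 ge_min lexx.
apply: superlinear_bind => [|j]; last exact: superlinear_ret.
apply: superlinear_categorical => j; apply: divr_ge0; last exact: q0.
by rewrite subr_ge0 ge_min lexx orbT.
Qed.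

Lemma superlinear_cres N (om : N.-tuple (R * R)) n : nonneg_weights om ->
  superlinear_law (cres om n).
Proof. by move=> om0; apply: superlinear_indep => _; exact: superlinear_cres1. Qed.

(** The two indices are equal and good with probability at least the overlap carried by the good
    indices; [a] bounds [f] there and [a + b] everywhere. *)
Lemma cres1_le N (om : N.-tuple (R * R)) (good : pred 'I_N)
    (f : 'I_N * 'I_N -> \bar R) (a b : R) :
  nonneg_weights om ->
  (0 < \sum_i (tnth om i).1)%R -> (0 < \sum_i (tnth om i).2)%R ->
  (0 <= b)%R -> (forall I, f I <= (a + b)%:E) ->
  (forall i, good i -> f (i, i) <= a%:E) ->
  cres1 om f <= (a + b * (1 - \sum_(i | good i) overlap om i))%:E.
Proof.
move=> om0 S0 S0' b0 fab fa; have v0 i := overlap_ge0 i om0.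
have p1 := sum_overlap_le1 om.
have p0 : (0 <= \sum_i overlap om i)%R by apply: sumr_ge0 => i _; exact: v0.
pose w (i : 'I_N) := ((tnth om i).1 / \sum_(j < N) (tnth om j).1)%R.
pose w' (i : 'I_N) := ((tnth om i).2 / \sum_(j < N) (tnth om j).2)%R.
pose v := overlap om; pose p := (\sum_i v i)%R.
rewrite -/v -/p in v0 p0 p1 *.
change (p%:E * categorical (fun i => v i / p)%R (fun i => f (i, i)) +
  (1 - p)%:E * categorical (fun i => (w i - v i) / (1 - p))%R (fun i =>
     categorical (fun j => (w' j - v j) / (1 - p))%R (fun j => f (i, j))) <=
  (a + b * (1 - \sum_(i | good i) v i))%:E).
have sw : (\sum_i w i = 1)%R by rewrite -mulr_suml divff// gt_eqF.
have sw' : (\sum_i w' i = 1)%R by rewrite -mulr_suml divff// gt_eqF.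
have gp : (\sum_(i | good i) v i <= p)%R.
  by rewrite /p [leRHS](bigID good)/= lerDl sumr_ge0.
have g0 : (0 <= \sum_(i | good i) v i)%R by apply: sumr_ge0.
(* The bound is split into the shares of the two branches: the common draw, of mass [p], and the
   independent residual draws, of mass [1 - p]. *)
have -> : (a + b * (1 - \sum_(i | good i) v i) =
  (a * p + b * (p - \sum_(i | good i) v i)) + (1 - p) * (a + b))%R by ring.
rewrite [leRHS]EFinD; apply: leeD.
  (* When [p = 0] the weights [v i / p] are meaningless, but this branch has factor zero and the
     good overlap vanishes too. *)
  have [pe0|pn0] := eqVneq p 0%R.
    have -> : (\sum_(i | good i) v i = 0)%R.
      by apply/eqP; rewrite eq_le g0 andbT -[leRHS]pe0.
    by rewrite pe0 mul0e mulr0 subrr mulr0 addr0.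
  apply: le_trans (_ : p%:E *
     (\sum_(i < N) (v i / p) * (a + b * (~~ good i)%:R))%:E <= _).
    apply: lee_wpmul2l; first by rewrite lee_fin.
    apply: (@categorical_le _ (fun i => v i / p)%R _
      (fun i => a + b * (~~ good i)%:R)%R) => i; first by rewrite divr_ge0.
    by case: (boolP (good i)) => gi; rewrite ?mulr0 ?mulr1 ?addr0; [exact: fa|exact: fab].
  rewrite -EFinM lee_fin mulr_sumr.
  under eq_bigr => i _ do
    rewrite mulrA mulrCA mulfV// mulr1 mulrDr (mulrC (v i)) (mulrCA (v i)).
  rewrite big_split/= -!mulr_sumr lerD// ler_wpM2l//.
  rewrite lerBrDl /p [leRHS](bigID good)/= lerD2l [leRHS]big_mkcond/= le_eqVlt.
  by apply/orP; left; apply/eqP/eq_bigr => i _; case: (good i); rewrite ?mulr0 ?mulr1.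
rewrite [leRHS]EFinM.
have [->|pn1] := eqVneq p 1%R; first by rewrite subrr !mul0e.
have q0 : (0 < 1 - p)%R by rewrite subr_gt0 lt_neqAle pn1.
(* A residual [u - v] has total mass [1 - p], so that it is a probability vector once divided by
   [1 - p]. *)
have cat1 (u : 'I_N -> R) h : (forall i, v i <= u i)%R -> (\sum_i u i = 1)%R ->
    (forall i, h i <= (a + b)%:E) ->
    categorical (fun i => (u i - v i) / (1 - p))%R h <= (a + b)%:E.
  move=> vu su hab.
  apply: le_trans (categorical_le (g := fun=> (a + b)%R) _ hab) _.
    by move=> i; rewrite divr_ge0 ?subr_ge0// -subr_ge0 ltW.
  rewrite lee_fin -!mulr_suml sumrB su -/p mulfV ?mul1r//.
  by rewrite gt_eqF.
rewrite lee_wpmul2l ?lee_fin ?(ltW q0)//.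
apply: (cat1) => // [i|i]; first by rewrite ge_min lexx.
by apply: (cat1) => // j; rewrite ge_min lexx orbT.
Qed.

(** On good indices the raw weights are equal, so the normalized weight is smaller for the vector
    with the larger total. The missing overlap is then the bad mass of that vector, which is at most
    the number of bad indices times [hi / (N lo)]. *)
Lemma overlap_same_weights N (om : N.-tuple (R * R)) (good : pred 'I_N)
    (lo hi eps : R) : (0 < N)%N -> (0 < eps)%R -> (0 < lo)%R ->
  (eps * hi <= lo)%R ->
  (forall i, lo <= (tnth om i).1 <= hi /\ lo <= (tnth om i).2 <= hi)%R ->
  (forall i, good i -> (tnth om i).1 = (tnth om i).2) ->
  (1 - \sum_(i | good i) overlap om i <=
   (\sum_(i < N) ~~ good i)%N%:R / (eps * N%:R))%R.
Proof.
move=> N0 e0 lo0 ehl omb omg.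
have NR0 : (0 < N%:R :> R)%R by rewrite ltr0n.
have mass (a : 'I_N -> R) : (forall i, lo <= a i <= hi)%R ->
    (0 < \sum_i a i)%R /\
    (1 - \sum_(i | good i) a i / \sum_j a j <=
     (\sum_(i < N) ~~ good i)%N%:R / (eps * N%:R))%R.
  move=> ab.
  have Sl : (N%:R * lo <= \sum_i a i)%R.
    rewrite mulr_natl -[X in (_ *+ X)%R]card_ord -sumr_const.
    by apply: ler_sum => i _; case/andP: (ab i).
  have S0 : (0 < \sum_i a i)%R by apply: lt_le_trans Sl; rewrite mulr_gt0.
  split=> //.
  have -> : (1 - \sum_(i | good i) a i / \sum_j a j =
     (\sum_(i | ~~ good i) a i) / \sum_j a j)%R.
    rewrite -mulr_suml -{1}(divff (lt0r_neq0 S0)) -mulrBl; congr (_ / _)%R.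
    by rewrite {1}(bigID good)/= addrAC subrr add0r.
  rewrite ler_pdivrMr// mulrAC ler_pdivlMr ?mulr_gt0//.
  have Bh : (\sum_(i | ~~ good i) a i <= (\sum_(i < N) ~~ good i)%N%:R * hi)%R.
    rewrite natr_sum mulr_suml big_mkcond/=; apply: ler_sum => i _.
    by case: (good i); rewrite ?mul0r// mul1r; case/andP: (ab i).
  apply: le_trans (_ : ((\sum_(i < N) ~~ good i)%N%:R * hi) * (eps * N%:R) <= _)%R.
    by rewrite ler_wpM2r// ltW// mulr_gt0.
  rewrite -mulrA ler_wpM2l//; apply: le_trans Sl.
  by rewrite mulrA [leLHS]mulrC ler_pM2l// mulrC.
have [S1 m1] := mass (fun i => (tnth om i).1) (fun i => (omb i).1).
have [S2 m2] := mass (fun i => (tnth om i).2) (fun i => (omb i).2).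
have pos i : (0 <= (tnth om i).1)%R /\ (0 <= (tnth om i).2)%R.
  by case: (omb i) => /andP[/(lt_le_trans lo0)/ltW ? _] /andP[/(lt_le_trans lo0)/ltW ? _].
have [S12|/ltW S21] := leP (\sum_i (tnth om i).1)%R (\sum_i (tnth om i).2)%R.
  apply: le_trans m2; rewrite lerB//; apply: ler_sum => i gi.
  rewrite le_min lexx andbT (omg i gi) ler_wpM2l ?lef_pV2//.
  by case: (pos i).
apply: le_trans m1; rewrite lerB//; apply: ler_sum => i gi.
rewrite le_min lexx/= -(omg i gi) ler_wpM2l ?lef_pV2//.
by case: (pos i).
Qed.

(** Without any relation between the two vectors, every normalized weight is still at least
    [eps / N], so the good indices carry an overlap of at least [eps / N] each. *)
Lemma overlap_balanced_weights N (om : N.-tuple (R * R)) (good : pred 'I_N)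
    (lo hi eps : R) : (0 < N)%N -> (0 < eps <= 1)%R -> (0 < lo)%R ->
  (eps * hi <= lo)%R ->
  (forall i, lo <= (tnth om i).1 <= hi /\ lo <= (tnth om i).2 <= hi)%R ->
  (1 - \sum_(i | good i) overlap om i <=
   1 - eps + (\sum_(i < N) ~~ good i)%N%:R / (eps * N%:R))%R.
Proof.
move=> N0 /andP[e0 e1] lo0 ehl omb.
have NR0 : (0 < N%:R :> R)%R by rewrite ltr0n.
have hi0 : (0 < hi)%R.
  apply: lt_le_trans lo0 _; case: (omb (Ordinal N0)) => /andP[h1 h2] _.
  exact: le_trans h2.
have mass (a : 'I_N -> R) i : (forall i, lo <= a i <= hi)%R ->
    (eps / N%:R <= a i / \sum_j a j)%R.
  move=> ab.
  have Sl : (\sum_i a i <= N%:R * hi)%R.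
    rewrite mulr_natl -[X in (_ *+ X)%R]card_ord -sumr_const.
    by apply: ler_sum => j _; case/andP: (ab j).
  have S0 : (0 < \sum_i a i)%R.
    rewrite (bigD1 i)//= ltr_wpDr//.
      by apply: sumr_ge0 => j _; apply: le_trans (ltW lo0) _; case/andP: (ab j).
    by apply: lt_le_trans lo0 _; case/andP: (ab i).
  rewrite ler_pdivlMr// mulrAC ler_pdivrMr//.
  apply: le_trans (_ : eps * (N%:R * hi) <= _)%R; first by rewrite ler_pM2l.
  rewrite mulrCA mulrC ler_pM2r//; apply: le_trans ehl _.
  by case/andP: (ab i).
have vb i : (eps / N%:R <= overlap om i)%R.
  by rewrite le_min (mass (fun i => (tnth om i).1)) ?(mass (fun i => (tnth om i).2))// => j;
     case: (omb j).
rewrite -addrA lerD2l lerNl opprD opprK.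
apply: le_trans (_ : \sum_(i | good i) eps / N%:R <= _)%R; last exact: ler_sum.
have -> : (\sum_(i < N | good i) eps / N%:R =
           eps - (\sum_(i < N) ~~ good i)%N%:R * (eps / N%:R))%R.
  have tot : (\sum_(i < N) eps / N%:R = eps)%R.
    by rewrite sumr_const card_ord -(mulr_natr (eps / _)) mulfVK// gt_eqF.
  have -> : ((\sum_(i < N) ~~ good i)%N%:R * (eps / N%:R) =
             \sum_(i < N | ~~ good i) eps / N%:R)%R.
    rewrite natr_sum mulr_suml [RHS]big_mkcond/=; apply: eq_bigr => i _.
    by case: (good i); rewrite ?mul0r ?mul1r.
  by apply/eqP; rewrite eq_sym subr_eq -(bigID good predT)/= tot.
(* The correction [eps / N] per bad index is weakened to [1 / (eps N)], the form of the bound for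
   equal weights, using [eps * eps <= 1]. *)
rewrite lerD2l lerN2 ler_wpM2l// -[leRHS]mul1r ler_pdivlMr ?mulr_gt0// mulrAC ler_pdivrMr//.
have : (eps * eps <= 1)%R by rewrite mulr_ile1 // ltW.
nra.
Qed.

End finite_laws.

(** * One iteration of the coupled filter *)

Section potential.
Context {R : realType} {X : eqType}.
Variables (al ka : R).

(** For paths of equal length this is [D]: the number of coordinates from the first disagreement
    onwards. *)
Fixpoint uncoupled (s s' : seq X) : nat :=
  match s, s' with
  | x :: u, x' :: u' => if x == x' then uncoupled u u' else size s
  | _, _ => 0
  end.

Definition potential (s s' : seq X) : R :=
  (if uncoupled s s' == 0%N then 0 else al ^+ uncoupled s s')%R.

(* The extra factor [ka] while the heads differ pays for the steps that the
   backward pass needs to couple again: this makes [boosted] a supermartingale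
   along the backward pass, up to the contribution of the discrepancies. *)
Definition boosted (s s' : seq X) : R :=
  match s, s' with
  | x :: u, x' :: u' =>
      if x == x' then potential u u' else (ka * al ^+ size s)%R
  | _, _ => 0%R
  end.

Hypothesis al1 : (1 <= al)%R.
Hypothesis ka1 : (1 <= ka)%R.

Lemma uncoupled_size s s' : (uncoupled s s' <= size s)%N.
Proof.
elim: s s' => [|x s IH] [|x' s'] //=; case: ifP => // _.
exact: leq_trans (IH s') (leqnSn _).
Qed.

Lemma potential_ge0 s s' : (0 <= potential s s')%R.
Proof.
by rewrite /potential; case: ifP => // _; rewrite exprn_ge0// (le_trans ler01).
Qed.

Lemma potential_le s s' k : (size s <= k)%N -> (potential s s' <= al ^+ k)%R.
Proof.
move=> sk; rewrite /potential; case: ifP => _.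
  by rewrite exprn_ge0// (le_trans ler01).
by rewrite ler_weXn2l// (leq_trans (uncoupled_size _ _)).
Qed.

Lemma boosted_ge0 s s' : (0 <= boosted s s')%R.
Proof.
case: s s' => [|x s] [|x' s'] //=; case: ifP => // _; first exact: potential_ge0.
by rewrite mulr_ge0 ?exprn_ge0// (le_trans ler01).
Qed.

Lemma boosted_le s s' : (boosted s s' <= ka * al ^+ size s)%R.
Proof.
have al0 : (0 <= al)%R by exact: le_trans al1.
case: s s' => [|x s] [|x' s'] //=; rewrite ?mulr_ge0 ?exprn_ge0 ?(le_trans ler01)//.
case: ifP => // _; rewrite (le_trans (potential_le _ (leqnSn _)))//.
by rewrite ler_peMl// exprn_ge0.
Qed.

Lemma potential_le_boosted s s' : (potential s s' <= boosted s s')%R.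
Proof.
case: s s' => [|x s] [|x' s'] //=; rewrite /potential/=; case: (x == x') => //=.
by rewrite ler_peMl// exprn_ge0// (le_trans ler01).
Qed.

Lemma uncoupled_eq0 (s s' : seq X) : size s = size s' ->
  (uncoupled s s' == 0%N) = (s == s').
Proof.
elim: s s' => [|x s IH] [|x' s']//= [/IH sE].
by rewrite eqseq_cons; case: (x == x') => /=.
Qed.

End potential.

(** Strong mixing in terms of real bounds and without quotients. [eps_G] controls the weights used
    in forward resampling and in the last draw, [eps_GMG] the backward weights. *)
Record mixing_bounds (R : realType) d (X : measurableType d) (eps : R) (T : nat)
    (m : model R X) (gl gu ml mh : nat -> R) : Prop := {
  gl_gt0 : forall t, (1 <= t <= T)%N -> (0 < gl t)%R ;
  ml_gt0 : forall t, (2 <= t <= T)%N -> (0 < ml t)%R ;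
  G1_bounds : forall x, (gl 1 <= G1 m x <= gu 1)%R ;
  Gt_bounds : forall t, (2 <= t <= T)%N ->
    forall x y, (gl t <= Gt m t x y <= gu t)%R ;
  Mt_bounds : forall t, (2 <= t <= T)%N ->
    forall x y, (ml t <= Mt m t x y <= mh t)%R ;
  eps_G : forall t, (1 <= t <= T)%N -> (eps * gu t <= gl t)%R ;
  eps_GMG : forall t, (1 <= t < T)%N ->
    (eps * (gu t * mh t.+1 * gu t.+1) <= gl t * ml t.+1 * gl t.+1)%R }.

Section ccbpf_step.
Context {R : realType} d (X : measurableType d).
Variable mu : {sigma_finite_measure set X -> \bar R}.
Variables (m : model R X) (C : couplings R X).
Variables (T : nat) (eps : R) (gl gu ml mh : nat -> R).
Hypothesis eps01 : (0 < eps <= 1)%R.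
Hypothesis mP : is_model mu T m.
Hypothesis mB : mixing_bounds eps T m gl gu ml mh.
Variable n : nat.
Let N := n.+1.
Implicit Types (Z : N.-tuple (X * X)) (om : N.-tuple (R * R)).

Definition bounded_weights t om : Prop :=
  forall i, (gl t <= (tnth om i).1 <= gu t /\ gl t <= (tnth om i).2 <= gu t)%R.

(** The weights are compared as well, because a weight depends on the parent: equal states may carry
    different weights. *)
Definition agree Z om (i : 'I_N) : bool :=
  ((tnth Z i).1 == (tnth Z i).2) && ((tnth om i).1 == (tnth om i).2).

Definition discrepancy Z om : nat := (\sum_(i < N) ~~ agree Z om i)%N.

Definition miss Z om (J : 'I_N * 'I_N) : bool :=
  ~~ ((J.1 == J.2) && agree Z om J.1).

Let e0 : (0 < eps)%R. Proof. by case/andP: eps01. Qed.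

Lemma bounded_weights_nonneg t om : (1 <= t <= T)%N -> bounded_weights t om ->
  nonneg_weights om.
Proof.
move=> tT omb i; have g0 := gl_gt0 mB tT.
by case: (omb i) => /andP[/(lt_le_trans g0)/ltW ? _] /andP[/(lt_le_trans g0)/ltW ? _].
Qed.

Lemma sum_gt0_of_lower (a : 'I_N -> R) lo : (0 < lo)%R -> (forall i, lo <= a i)%R ->
  (0 < \sum_i a i)%R.
Proof.
move=> lo0 la; rewrite (bigD1 ord0)//= ltr_wpDr//.
  by apply: sumr_ge0 => j _; apply: le_trans (ltW lo0) _.
exact: lt_le_trans (la _).
Qed.

Lemma bounded_cres1_le om lo hi (good : pred 'I_N) f (a b : R) : (0 < lo)%R ->
  (forall i, lo <= (tnth om i).1 <= hi /\ lo <= (tnth om i).2 <= hi)%R ->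
  (0 <= b)%R -> (forall I, f I <= (a + b)%:E) ->
  (forall i, good i -> f (i, i) <= a%:E) ->
  cres1 om f <= (a + b * (1 - \sum_(i | good i) overlap om i))%:E.
Proof.
move=> lo0 omb b0 fab fa; apply: cres1_le => //.
- by move=> i; case: (omb i) => /andP[/(lt_le_trans lo0)/ltW ? _]
    /andP[/(lt_le_trans lo0)/ltW ? _].
- by apply: (sum_gt0_of_lower lo0) => i; case: (omb i) => /andP[].
- by apply: (sum_gt0_of_lower lo0) => i; case: (omb i) => _ /andP[].
Qed.

Lemma cres1_miss_le t Z om f (a b : R) : (1 <= t <= T)%N ->
  bounded_weights t om -> (0 <= b)%R ->
  (forall J, f J <= (a + b * (miss Z om J)%:R)%:E) ->
  cres1 om f <= (a + b * ((discrepancy Z om)%:R / (eps * N%:R)))%:E.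
Proof.
move=> tT omb b0 fab.
apply: le_trans (bounded_cres1_le (good := agree Z om) (a := a) (gl_gt0 mB tT)
  omb b0 _ _) _.
- move=> J; apply: le_trans (fab J) _; rewrite lee_fin lerD2l.
  by case: (miss _ _ _); rewrite ?mulr1 ?mulr0.
- by move=> i gi; apply: le_trans (fab _) _; rewrite /miss/= eqxx gi mulr0 addr0.
rewrite lee_fin lerD2l ler_wpM2l//.
apply: (overlap_same_weights _ e0 (gl_gt0 mB tT) (eps_G mB tT) omb) => // i.
by move=> /andP[_ /eqP].
Qed.

Lemma backward_weights_bounds t Z om y y' : (1 <= t < T)%N ->
  bounded_weights t om -> forall i,
  let bw := tnth (backward_weights m t Z om y y') i in
  let lo := (gl t * ml t.+1 * gl t.+1)%R in
  let hi := (gu t * mh t.+1 * gu t.+1)%R in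
  (lo <= bw.1 <= hi /\ lo <= bw.2 <= hi)%R.
Proof.
move=> /andP[t1 tT] omb i; rewrite tnth_mktuple/=.
have tT1 : (2 <= t.+1 <= T)%N by rewrite ltnS t1.
have g0 : (0 < gl t)%R by apply: (gl_gt0 mB); rewrite t1 ltnW.
have g0' : (0 < gl t.+1)%R by apply: (gl_gt0 mB).
have m0 := ml_gt0 mB tT1.
have prod w x z : (gl t <= w <= gu t)%R -> (gl t * ml t.+1 * gl t.+1 <=
    w * Mt m t.+1 x z * Gt m t.+1 x z <= gu t * mh t.+1 * gu t.+1)%R.
  move=> /andP[w1 w2].
  have /andP[M1 M2] := Mt_bounds mB tT1 x z.
  have /andP[G1 G2] := Gt_bounds mB tT1 x z.
  have w0 := le_trans (ltW g0) w1; have M0 := le_trans (ltW m0) M1.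
  have G0 := le_trans (ltW g0') G1.
  by rewrite !ler_pM// ?mulr_ge0// ?ltW.
by case: (omb i) => o1 o2; split; exact: prod.
Qed.

Lemma backward_lower_gt0 t : (1 <= t < T)%N ->
  (0 < gl t * ml t.+1 * gl t.+1)%R.
Proof.
move=> /andP[t1 tT]; rewrite !mulr_gt0//.
- by apply: (gl_gt0 mB); rewrite t1 ltnW.
- by apply: (ml_gt0 mB); rewrite ltnS t1.
- exact: (gl_gt0 mB).
Qed.

Lemma backward_weights_nonneg t Z om y y' : (1 <= t < T)%N ->
  bounded_weights t om -> nonneg_weights (backward_weights m t Z om y y').
Proof.
move=> tT omb i; have l0 := backward_lower_gt0 tT.
by have [/andP[/(lt_le_trans l0)/ltW ? _] /andP[/(lt_le_trans l0)/ltW ? _]] :=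
  backward_weights_bounds Z y y' tT omb i.
Qed.

Variables (al ka : R).
Hypothesis al1 : (1 <= al)%R.
Hypothesis ka1 : (1 <= ka)%R.
Hypothesis ka_al : (eps + (1 - eps) * al * ka <= ka)%R.

Local Notation bst := (boosted al ka).

(** If the selected states at time [t.+1] are equal, agreeing particles have equal backward weights,
    and the paths separate only with probability of order [discrepancy / N]. If they differ, the
    indices meet with probability about [eps], and [ka_al] says that the gain from meeting
    compensates the factor [al] paid otherwise. The constant [a] is carried along since it cannot be
    taken out of a law. *)
Lemma backward_boosted_le t Z om k (p : k.+1.-tuple X * k.+1.-tuple X) (a : R) :
  (1 <= t < T)%N -> bounded_weights t om ->
  cres1 (backward_weights m t Z om (thead p.1) (thead p.2))
    (fun J => (bst ((tnth Z J.1).1 :: p.1) ((tnth Z J.2).2 :: p.2) + a)%:E) <=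
  (bst p.1 p.2 +
   (ka * al ^+ k.+2 * ((discrepancy Z om)%:R / (eps * N%:R)) + a))%:E.
Proof.
move=> tT omb; case: p => /= p p'.
case/tupleP: p => y s; case/tupleP: p' => y' s'; rewrite !theadE.
have lo0 := backward_lower_gt0 tT; have ehl := eps_GMG mB tT.
have bwb := backward_weights_bounds Z y y' tT omb.
have al0 : (0 <= al)%R by exact: le_trans al1.
have top : (0 <= ka * al ^+ k.+2)%R by rewrite mulr_ge0 ?exprn_ge0 ?(le_trans ler01).
have up x x' : (bst [:: x, y & s] [:: x', y' & s'] <= ka * al ^+ k.+2)%R.
  by apply: le_trans (boosted_le al1 ka1 _ _) _; rewrite /= size_tuple.
have [yy'|yy'] := eqVneq y y'.
  subst y'; apply: le_trans (bounded_cres1_le (good := agree Z om)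
    (a := (potential al s s' + a)%R) (b := (ka * al ^+ k.+2)%R) lo0 bwb top _ _) _.
  - move=> J; rewrite lee_fin addrAC lerD2r; apply: le_trans (up _ _) _.
    by rewrite lerDr potential_ge0.
  - move=> i /andP[/eqP-> _] /=; rewrite eqxx /potential/= eqxx lexx//.
  rewrite lee_fin /= eqxx [leRHS]addrA [leLHS]addrAC lerD2r lerD2l ler_wpM2l//.
  apply: (overlap_same_weights _ e0 lo0 ehl bwb) => // i /andP[/eqP Zi /eqP oi].
  by rewrite tnth_mktuple/= Zi oi.
(* Meeting at an agreeing particle leaves at most [al ^+ k.+1], any other outcome at most
   [ka * al ^+ k.+2]; the difference plays the role of [b]. *)
have d0 : (0 <= ka * al ^+ k.+2 - al ^+ k.+1)%R.
  rewrite subr_ge0 (exprS al k.+1) mulrA ler_peMl ?exprn_ge0//.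
  by rewrite -[1%R]mulr1 ler_pM.
apply: le_trans (bounded_cres1_le (good := agree Z om)
  (a := (al ^+ k.+1 + a)%R) lo0 bwb d0 _ _) _.
- move=> J; rewrite lee_fin; apply: le_trans (lerD (up _ _) (lexx a)) _; lra.
- move=> i /andP[/eqP-> _] /=; rewrite eqxx lee_fin lerD2r.
  by rewrite potential_le//= size_tuple.
rewrite lee_fin /= (negbTE yy') /= size_tuple.
set D := (_ / (eps * _))%R.
have D0 : (0 <= D)%R by rewrite divr_ge0// mulr_ge0// ltW.
have := overlap_balanced_weights (agree Z om) (ltn0Sn n) eps01 lo0 ehl bwb.
rewrite -/(discrepancy Z om) -/D; set v := (1 - \sum_(i | _) _)%R => vD.
have A0 : (0 <= al ^+ k.+1)%R by rewrite exprn_ge0.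
have h1 := ler_wpM2l d0 vD.
have h2 := ler_wpM2l A0 ka_al.
have h3 := mulr_ge0 A0 D0.
move: h1 h2; rewrite (exprS al k.+1) => h1 h2.
rewrite addrAC; apply: le_trans (lerD (lerD (lexx _) h1) (lexx _)) _.
nra.
Qed.

Lemma bindA (Y1 Y2 Y3 : Type) (l : @law R Y1) (k : Y1 -> @law R Y2)
    (h : Y2 -> @law R Y3) : bind (bind l k) h = bind l (fun y => bind (k y) h).
Proof. by []. Qed.

Lemma superlinear_coupled_init : superlinear_law (coupled_init mu m).
Proof.
apply: superlinear_bind => [|x]; last exact: superlinear_ret.
exact/superlinear_draw_density/(M1_ge0 mP).
Qed.

Lemma superlinear_coupled_move t x y : (2 <= t <= T)%N ->
  superlinear_law (coupled_move mu m C t x y).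
Proof.
move=> tT; rewrite /coupled_move; case: ifP => _; last exact: superlinear_draw.
apply: superlinear_bind => [|z]; last exact: superlinear_ret.
by apply: superlinear_draw_density => z; exact: (Mt_ge0 mP).
Qed.

Lemma draw_density_le d0 (Y : measurableType d0) (nu : {measure set Y -> \bar R})
    (p : Y -> R) f (a : R) : measurable_fun setT p -> (forall y, 0 <= p y)%R ->
  \int[nu]_y (p y)%:E = 1 -> (0 <= a)%R -> (forall y, 0 <= f y) ->
  (forall y, f y <= a%:E) -> draw_density nu p f <= a%:E.
Proof.
move=> mp p0 p1 a0 f0 fa; rewrite /draw_density.
apply: le_trans (_ : \int[nu]_y ((p y)%:E * a%:E) <= _).
  apply: integral_mono => y _; first by rewrite mule_ge0 ?lee_fin.
  by rewrite lee_wpmul2l ?lee_fin.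
rewrite ge0_integralZr// ?p1 ?mul1e//; first exact/measurable_EFinP.
by move=> y _; rewrite lee_fin.
Qed.

Lemma supported_coupled_init :
  supported (coupled_init mu m) [set z | z.1 = z.2].
Proof.
move=> f a a0 f0 fa; rewrite /coupled_init /bind /ret.
apply: draw_density_le => //.
- exact: (M1_measurable mP).
- exact: (M1_ge0 mP).
- exact: (M1_density mP).
- by move=> y; exact: fa.
Qed.

Lemma supported_coupled_move t x y : (2 <= t <= T)%N ->
  supported (coupled_move mu m C t x y) [set z | x = y -> z.1 = z.2].
Proof.
move=> tT f a a0 f0 fa; rewrite /coupled_move; case: eqP => xy.
  rewrite /bind /ret; apply: draw_density_le => //.
  - exact: (measurableT_comp (Mt_measurable mP tT) (pair1_measurable x)).
  - by move=> z; exact: (Mt_ge0 mP).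
  - exact: (Mt_density mP).
  - by move=> z; exact: fa.
rewrite /draw; apply: le_trans (_ : \int[C t (x, y)]_z a%:E <= _).
  by apply: integral_mono => // z _; exact: fa.
by rewrite integral_cst// prob_kernel mule1.
Qed.

Lemma bounded_init_weights Z : bounded_weights 1 (init_weights m Z).
Proof. by move=> i; rewrite tnth_mktuple/=; split; exact: (G1_bounds mB). Qed.

Lemma bounded_move_weights t parent Z : (2 <= t <= T)%N ->
  bounded_weights t (move_weights m t parent Z).
Proof. by move=> tT i; rewrite tnth_mktuple/=; split; exact: (Gt_bounds mB). Qed.

(** The continuation is superlinear only for bounded weights, so the general composition lemma does
    not apply; the forward step is opened to see that it produces nothing else. *)
Lemma superlinear_forward_step_bind (Y : Type) t r r' Z om
    (k : N.-tuple (X * X) * N.-tuple (R * R) -> @law R Y) :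
  (1 <= t < T)%N -> bounded_weights t om ->
  (forall Z' om', bounded_weights t.+1 om' -> superlinear_law (k (Z', om'))) ->
  superlinear_law (bind (forward_step mu m C t.+1 r r' Z om) k).
Proof.
move=> /andP[t1 tT] omb sk; have tT1 : (2 <= t.+1 <= T)%N by rewrite ltnS t1.
rewrite /forward_step bindA; apply: superlinear_bind => [|Is].
  by apply/superlinear_cres/(bounded_weights_nonneg _ omb); rewrite t1 ltnW.
rewrite bindA; apply: superlinear_bind => [|Zs].
  by apply: superlinear_indep => i; exact: superlinear_coupled_move.
by apply: sk; exact: bounded_move_weights.
Qed.

Lemma superlinear_forward_backward k t (r : k.-tuple X * k.-tuple X) Z om :
  (1 <= t)%N -> (t + k)%N = T -> bounded_weights t om ->
  superlinear_law (forward_backward mu m C t r Z om).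
Proof.
elim: k t r Z om => [|k IH] t r Z om t1 tkT omb /=.
  apply: superlinear_bind => [|J]; last exact: superlinear_ret.
  apply/superlinear_cres1/(bounded_weights_nonneg _ omb).
  by rewrite t1 -tkT leq_addr.
have tT : (1 <= t < T)%N by rewrite t1 -tkT addnS ltnS leq_addr.
apply: superlinear_forward_step_bind => // Z' om' omb'.
apply: superlinear_bind => [|p]; first by apply: IH => //; rewrite addSnnS.
apply: superlinear_bind => [|J]; last exact: superlinear_ret.
exact/superlinear_cres1/backward_weights_nonneg.
Qed.

Lemma superlinear_ccbpf_steps k (s : k.+1.-tuple X * k.+1.-tuple X) :
  k.+1 = T -> superlinear_law (ccbpf_steps mu m C n s).
Proof.
move=> kT; rewrite /ccbpf_steps /forward_init bindA.
apply: superlinear_bind => [|Zs].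
  by apply: superlinear_indep => _; exact: superlinear_coupled_init.
by apply: superlinear_forward_backward => //; exact: bounded_init_weights.
Qed.

(* The new reference particle agrees if the references do and the previous
   reference particles did; any other new particle agrees if its parents were
   the same agreeing particle. *)
Lemma forward_step_le t r r' Z om f (a b : R) :
  (1 <= t < T)%N -> bounded_weights t om -> (0 <= a)%R -> (0 <= b)%R ->
  (forall Z' om', bounded_weights t.+1 om' -> 0 <= f (Z', om')) ->
  (forall Z' om' (e : nat), bounded_weights t.+1 om' ->
     (discrepancy Z' om' <=
       ~~ ((r == r') && ((tnth Z ord0).1 == (tnth Z ord0).2)) + e)%N ->
     f (Z', om') <= (a + b * e%:R)%:E) ->
  forward_step mu m C t.+1 r r' Z om f <=
  (a + b * (n%:R * ((discrepancy Z om)%:R / (eps * N%:R))))%:E.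
Proof.
move=> /andP[t1 tT] omb a0 b0 f0 fab.
have tT1 : (2 <= t.+1 <= T)%N by rewrite ltnS t1.
rewrite /forward_step {1}/bind /cres.
apply: (indep_le_sum (bad := miss Z om)) => // [g a' b' b'0|Is].
  by apply: cres1_miss_le => //; rewrite t1 ltnW.
set e := (\sum_(i < n) miss Z om (tnth Is i))%N.
set I := [tuple of _ :: Is].
set parent := fun i : 'I_N => ((tnth Z (tnth I i).1).1, (tnth Z (tnth I i).2).2).
rewrite /bind /ret.
apply: (supported_indep (A := fun i => [set z : X * X |
  (parent (lift ord0 i)).1 = (parent (lift ord0 i)).2 -> z.1 = z.2])).
- by move=> i; exact: superlinear_coupled_move.
- by move=> i; exact: supported_coupled_move.
- by rewrite addr_ge0// mulr_ge0.
- by move=> Zs; apply: f0; exact: bounded_move_weights.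
move=> Zs /= Zsp; apply: fab; first exact: bounded_move_weights.
rewrite /discrepancy big_ord_recl leq_add//.
  rewrite /agree tnth_mktuple tnth0 /=.
  have [<-|_] := eqVneq r r' => //=.
  by have [->|_] := eqVneq (tnth Z ord0).1 (tnth Z ord0).2; rewrite ?eqxx ?leq_b1.
apply: leq_sum => i _; rewrite /miss; case: (boolP (_ && _)) => [|_]; last exact: leq_b1.
move=> /andP[/eqP I12 /andP[/eqP Zi _]].
have parent_i : (parent (lift ord0 i)).1 = (parent (lift ord0 i)).2.
  by rewrite /parent /I /= !tnthS -I12.
have zi := Zsp i parent_i.
by rewrite /agree tnth_mktuple tnthS parent_i zi !eqxx.
Qed.

Lemma forward_backwardS k t (r : k.+1.-tuple X * k.+1.-tuple X) Z om f :
  forward_backward mu m C t r Z om f =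
  forward_step mu m C t.+1 (thead r.1) (thead r.2) Z om (fun Zom =>
    forward_backward mu m C t.+1 ([tuple of behead r.1], [tuple of behead r.2])
      Zom.1 Zom.2 (fun p =>
        cres1 (backward_weights m t Z om (thead p.1) (thead p.2)) (fun J =>
          f ([tuple of (tnth Z J.1).1 :: p.1],
             [tuple of (tnth Z J.2).2 :: p.2])))).
Proof. by []. Qed.

Lemma backward_ge0 k t Z om (p : k.+1.-tuple X * k.+1.-tuple X)
    (f : 'I_N * 'I_N -> \bar R) : (1 <= t < T)%N ->
  bounded_weights t om -> (forall J, 0 <= f J) ->
  0 <= cres1 (backward_weights m t Z om (thead p.1) (thead p.2)) f.
Proof.
move=> tT omb f0; apply: (law_ge0 (superlinear_cres1 _)) => //.
exact: backward_weights_nonneg.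
Qed.

(** The total mass is at most 1: this is the case [b = 0] of the bounds for the single steps. *)
Lemma supported_forward_backward k t (r : k.-tuple X * k.-tuple X) Z om :
  (1 <= t)%N -> (t + k)%N = T -> bounded_weights t om ->
  supported (forward_backward mu m C t r Z om) setT.
Proof.
elim: k t r Z om => [|k IH] t r Z om t1 tkT omb f a a0 f0 fa.
  rewrite /= /bind /ret; have tT : (1 <= t <= T)%N by rewrite t1 -tkT leq_addr.
  apply: le_trans (cres1_miss_le (Z := Z) (a := a) (b := 0) tT omb _ _) _ => //.
    by move=> J; rewrite mul0r addr0; exact: fa.
  by rewrite mul0r addr0.
have tT : (1 <= t < T)%N by rewrite t1 -tkT addnS ltnS leq_addr.
have tkT' : (t.+1 + k)%N = T by rewrite addSnnS.
rewrite forward_backwardS.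
apply: le_trans (forward_step_le (a := a) (b := 0) tT omb _ _ _ _) _ => //.
- move=> Z' om' omb'; apply: (law_ge0 (superlinear_forward_backward _ _ _ _ _)) => //.
  by move=> p; exact: backward_ge0.
- move=> Z' om' e omb' _; rewrite mul0r addr0; apply: IH => // p.
    exact: backward_ge0.
  move=> _; apply: le_trans (bounded_cres1_le (good := pred0) (a := a) (b := 0)
    (backward_lower_gt0 tT) (backward_weights_bounds _ _ _ tT omb) _ _ _) _ => //.
    by move=> J; rewrite addr0; exact: fa.
  by rewrite mul0r addr0.
by rewrite mul0r addr0.
Qed.

(** The recursion in time. The last backward draw is integrated first, and its error, which depends
    only on the discrepancy at time [t], joins the constant [c] for the later times; the forward
    step then averages over the new discrepancy. *)
Lemma forward_backward_step_le k t (r : k.+1.-tuple X * k.+1.-tuple X) Z om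
    (c a b : R) : (1 <= t)%N -> (t + k.+1)%N = T -> bounded_weights t om ->
  (0 <= c)%R -> (0 <= a)%R -> (0 <= b)%R ->
  let D := ((discrepancy Z om)%:R / (eps * N%:R))%R in
  (forall Z' om' (e : nat), bounded_weights t.+1 om' ->
     (discrepancy Z' om' <= ~~ ((thead r.1 == thead r.2) &&
         ((tnth Z ord0).1 == (tnth Z ord0).2)) + e)%N ->
     forward_backward mu m C t.+1 ([tuple of behead r.1], [tuple of behead r.2])
       Z' om' (fun p => (bst p.1 p.2 + (ka * al ^+ k.+2 * D + c))%:E) <=
     (a + b * e%:R)%:E) ->
  forward_backward mu m C t r Z om (fun p => (bst p.1 p.2 + c)%:E) <=
  (a + b * (n%:R * D))%:E.
Proof.
move=> t1 tkT omb c0 a0 b0 D fab.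
have tT : (1 <= t < T)%N by rewrite t1 -tkT addnS ltnS leq_addr.
have tkT' : (t.+1 + k)%N = T by rewrite addSnnS.
have bst0 s s' : 0 <= (bst s s' + c)%:E by rewrite lee_fin addr_ge0// boosted_ge0.
rewrite forward_backwardS; apply: forward_step_le => //.
- move=> Z' om' omb'; apply: (law_ge0 (superlinear_forward_backward _ _ _ _ _)) => //.
  by move=> p; exact: backward_ge0.
- move=> Z' om' e omb' dis; apply: le_trans (fab _ _ _ omb' dis).
  apply: (law_mono (superlinear_forward_backward _ _ _ _ _)) => // p.
    exact: backward_ge0.
  exact: backward_boosted_le.
Qed.

(** [loss l u] bounds the expected [boosted] value relative to its maximum, for [u] present
    discrepancies and [l] steps of look-ahead. One step costs [u / (eps N)] in the backward draw and
    turns [u] into at most [1 + u / eps] on average, whence the recursions; [slope] and [drift] do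
    not depend on [N]. *)
Fixpoint slope l : R := (if l is l'.+1 then (1 + slope l') / eps else 0)%R.
Fixpoint drift l : R := (if l is l'.+1 then slope l' + drift l' else 0)%R.
Definition loss l (u : R) : R := (al ^- l + (slope l * u + drift l) / N%:R)%R.

Lemma slope_ge0 l : (0 <= slope l)%R.
Proof. by elim: l => //= l IH; rewrite divr_ge0 ?addr_ge0// ltW. Qed.

Lemma drift_ge0 l : (0 <= drift l)%R.
Proof. by elim: l => //= l IH; rewrite addr_ge0// slope_ge0. Qed.

Lemma loss_le l u v : (u <= v)%R -> (loss l u <= loss l v)%R.
Proof.
by move=> uv; rewrite lerD2l ler_wpM2r// lerD2r ler_wpM2l// slope_ge0.
Qed.

Lemma loss_ge0 l u : (0 <= u)%R -> (0 <= loss l u)%R.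
Proof.
move=> u0; have ? := slope_ge0 l; have ? := drift_ge0 l.
rewrite /loss addr_ge0//; first by rewrite invr_ge0 exprn_ge0// (le_trans ler01).
by rewrite divr_ge0// addr_ge0// mulr_ge0.
Qed.

Let al0 : (0 < al)%R. Proof. exact: lt_le_trans al1. Qed.
Let ka0 : (0 < ka)%R. Proof. exact: lt_le_trans ka1. Qed.
Let NR0 : (0 < N%:R :> R)%R. Proof. by rewrite ltr0n. Qed.

(* After [l] steps the backward pass may be started from scratch, at the cost
   [al ^- l]; the discrepancies accumulated meanwhile are of order one. *)
Lemma forward_backward_le l k t (r : k.-tuple X * k.-tuple X) Z om (c : R) :
  (1 <= t)%N -> (t + k)%N = T -> bounded_weights t om -> (0 <= c)%R ->
  forward_backward mu m C t r Z om (fun p => (bst p.1 p.2 + c)%:E) <=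
  (ka * al ^+ k.+1 * loss l (discrepancy Z om)%:R + c)%:E.
Proof.
elim: l k t r Z om c => [|l IH] k t r Z om c t1 tkT omb c0.
  rewrite /loss /= expr0 invr1 mul0r addr0 mul0r addr0 mulr1.
  apply: supported_forward_backward => //.
  - by rewrite addr_ge0// mulr_ge0 ?exprn_ge0 ?ltW.
  - by move=> p; rewrite lee_fin addr_ge0// boosted_ge0.
  - move=> p _; rewrite lee_fin lerD2r; apply: le_trans (boosted_le al1 ka1 _ _) _.
    by rewrite size_tuple.
set D := discrepancy Z om.
(* At the horizon only the final draw remains: [boosted] is 0 for equal states and [ka * al]
   otherwise, so a miss is the only cost. *)
case: k r tkT => [|k] r tkT.
  rewrite /= /bind /ret /=.
  have tT : (1 <= t <= T)%N by rewrite t1 -tkT leq_addr.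
  apply: le_trans (cres1_miss_le (Z := Z) (a := c) (b := (ka * al)%R) tT omb _ _) _.
  - by rewrite mulr_ge0 ?ltW.
  - move=> [i j]; rewrite lee_fin addrC lerD2l /= /potential/= expr1.
    case: ifPn => [_|xx]; first by rewrite mulr_ge0// mulr_ge0 ?ltW.
    rewrite (_ : miss Z om (i, j)) ?mulr1//.
    by apply: contra xx => /andP[/eqP/= <- /andP[]].
  rewrite lee_fin addrC lerD2r expr1; apply: ler_wpM2l; first by rewrite mulr_ge0 ?ltW.
  rewrite /loss /= -/D.
  have -> : (D%:R / (eps * N%:R) = 1 / eps * D%:R / N%:R :> R)%R.
    by rewrite invfM mul1r mulrA (mulrC _^-1 D%:R)%R.
  apply: le_trans (_ : ((1 + slope l) / eps * D%:R + (slope l + drift l)) / N%:R <= _)%R.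
    rewrite ler_pM2r ?invr_gt0//.
    apply: le_trans (_ : (1 + slope l) / eps * D%:R <= _)%R.
      by rewrite ler_wpM2r// ler_pM2r ?invr_gt0// lerDl slope_ge0.
    by rewrite lerDl addr_ge0 ?slope_ge0 ?drift_ge0.
  by rewrite lerDr invr_ge0 exprn_ge0// ltW.
have iN : (n%:R / N%:R <= 1 :> R)%R.
  by rewrite ler_pdivrMr// mul1r ler_nat leqnSn.
have s0 := slope_ge0 l; have dr0 := drift_ge0 l.
have u0 : (0 <= D%:R / (eps * N%:R) :> R)%R by rewrite divr_ge0// mulr_ge0 ?ltW.
set u := (D%:R / (eps * N%:R))%R in u0 *.
have P0 : (0 <= ka * al ^+ k.+1)%R by rewrite mulr_ge0 ?exprn_ge0 ?ltW.
have c'0 : (0 <= ka * al ^+ k.+2 * u + c)%R.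
  by rewrite addr_ge0// mulr_ge0// mulr_ge0 ?exprn_ge0 ?ltW.
(* At discrepancy [1 + e] the induction hypothesis is affine in [e], since [loss l (1 + e)] is
   [loss l 1 + slope l / N * e]; this gives [a] and [b]. *)
apply: le_trans (forward_backward_step_le
  (a := (ka * al ^+ k.+1 * loss l 1 + (ka * al ^+ k.+2 * u + c))%R)
  (b := (ka * al ^+ k.+1 * (slope l / N%:R))%R) _ tkT omb c0 _ _ _) _ => //.
- by rewrite addr_ge0// mulr_ge0// loss_ge0.
- by rewrite mulr_ge0// divr_ge0.
- move=> Z' om' e omb' dis; apply: le_trans (IH _ _ _ _ _ _ _ _ omb' c'0) _ => //.
    by rewrite addSnnS.
  rewrite lee_fin [leRHS]addrAC lerD2r -(mulrA _ (slope l / _)%R) -mulrDr ler_wpM2l//.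
  apply: le_trans (loss_le l (_ : _ <= 1 + e%:R)%R) _.
    by rewrite nat1r ler_nat -add1n (leq_trans dis)// leq_add2r leq_b1.
  by rewrite /loss le_eqVlt; apply/orP; left; apply/eqP; ring.
(* The path is one coordinate longer than in the induction hypothesis and [l] is one larger, so the
   leading terms match exactly; the others are compared through [al >= 1] and [n / N <= 1]. *)
have Q0 : (0 <= al ^- l)%R by rewrite invr_ge0 exprn_ge0 ?ltW.
have Qe : (al ^+ k.+2 * al ^- l.+1 = al ^+ k.+1 * al ^- l)%R.
  rewrite (exprS _ k.+1) (exprS _ l) invfM; field.
  by rewrite expf_neq0 ?lt0r_neq0.
rewrite lee_fin [X in (_ <= X)%R](_ : _ = ka * al ^+ k.+1 * al ^- l +
   al * (ka * al ^+ k.+1) * ((1 + slope l) * u) +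
   al * (ka * al ^+ k.+1) * ((slope l + drift l) / N%:R) + c)%R; last first.
  have -> : ((1 + slope l) * u = (1 + slope l) / eps * D%:R / N%:R)%R.
    by rewrite /u; field; rewrite !lt0r_neq0.
  rewrite -(mulrA ka _ (al ^- l)) -Qe /loss [slope l.+1]/= [drift l.+1]/=.
  set q := (al ^- l.+1)%R; rewrite (exprS al k.+1).
  ring.
rewrite /loss mulr1 (exprS al k.+1).
move: P0; set P := (ka * al ^+ k.+1)%R => P0.
have -> : (ka * (al * al ^+ k.+1) = al * P)%R by rewrite /P; ring.
set w := ((slope l + drift l) / N%:R)%R.
have w0 : (0 <= w)%R by rewrite divr_ge0 ?addr_ge0.
have h1 : (P * w <= al * P * w)%R by rewrite ler_wpM2r// ler_peMl.
have h2 : (P * (slope l / N%:R) * (n%:R * u) <= al * P * (slope l * u))%R.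
  have -> : (P * (slope l / N%:R) * (n%:R * u) =
             (n%:R / N%:R) * (P * (slope l * u)))%R by ring.
  rewrite -[leRHS]mulrA; apply: ler_wpM2r.
    by apply: mulr_ge0 => //; exact: mulr_ge0.
  exact: le_trans iN al1.
move: h2; rewrite -/D -/u; set V := (P * _ * _)%R => h2.
set Q := (al ^- l)%R.
nra.
Qed.

(** While the references agree, no discrepancy appears and the backward pass costs nothing, so the
    exponent involves the uncoupled length instead of the remaining horizon. The additional factor
    [al] accounts for the path starting one time before the first disagreement. *)
Lemma forward_backward_coupled_le l k t (r : k.-tuple X * k.-tuple X) Z om (c : R) :
  (1 <= t)%N -> (t + k)%N = T -> bounded_weights t om -> (0 <= c)%R ->
  discrepancy Z om = 0%N ->
  forward_backward mu m C t r Z om (fun p => (bst p.1 p.2 + c)%:E) <=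
  (ka * al ^+ (uncoupled r.1 r.2).+1 * loss l 1 + c)%:E.
Proof.
elim: k t r Z om c => [|k IH] t r Z om c t1 tkT omb c0 dis0.
  apply: le_trans (forward_backward_le l r Z t1 tkT omb c0) _.
  rewrite lee_fin lerD2r dis0 !tuple0 /= ler_wpM2l ?loss_le//.
  by rewrite mulr_ge0 ?exprn_ge0 ?ltW.
have [rr|rr] := eqVneq (thead r.1) (thead r.2); last first.
  apply: le_trans (forward_backward_le l r Z t1 tkT omb c0) _.
  rewrite lee_fin lerD2r dis0 (_ : uncoupled r.1 r.2 = k.+1) ?ler_wpM2l ?loss_le//.
    by rewrite mulr_ge0 ?exprn_ge0 ?ltW.
  case: r rr => p p'; case/tupleP: p => y s; case/tupleP: p' => y' s' /=.
  by rewrite !theadE => /negbTE->; rewrite size_tuple.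
have unc : uncoupled r.1 r.2 = uncoupled (behead r.1) (behead r.2).
  case: r rr => p p'; case/tupleP: p => y s; case/tupleP: p' => y' s' /=.
  by rewrite !theadE => ->; rewrite eqxx.
have Z0 : (tnth Z ord0).1 = (tnth Z ord0).2.
  move/eqP: dis0; rewrite /discrepancy big_ord_recl addn_eq0 => /andP[+ _].
  by rewrite eqb0 negbK => /andP[/eqP].
have P0 : (0 <= ka * al ^+ k.+1)%R by rewrite mulr_ge0 ?exprn_ge0 ?ltW.
have A0 : (0 <= ka * al ^+ (uncoupled r.1 r.2).+1 * loss l 1)%R.
  by rewrite mulr_ge0 ?loss_ge0// mulr_ge0 ?exprn_ge0 ?ltW.
(* Here [b] is only a crude finite bound for the case of a positive [e]; it ends up multiplied by
   the present discrepancy, which is zero. *)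
apply: le_trans (forward_backward_step_le
  (a := (ka * al ^+ (uncoupled r.1 r.2).+1 * loss l 1 + c)%R)
  (b := (ka * al ^+ k.+1)%R) _ tkT omb c0 _ _ _) _ => //.
- by rewrite addr_ge0.
- move=> Z' om' e omb'; rewrite rr Z0 !eqxx /= add0n dis0 mul0r mulr0 add0r => dis.
  have tkT' : (t.+1 + k)%N = T by rewrite addSnnS.
  case: e dis => [|e] dis.
    rewrite mulr0 addr0 unc; apply: (IH t.+1 ([tuple of _], [tuple of _])) => //.
    by apply/eqP; rewrite -leqn0.
  apply: (supported_forward_backward _ _ _ tkT' omb') => // [|p|p _].
  + by rewrite addr_ge0 ?addr_ge0// mulr_ge0.
  + by rewrite lee_fin addr_ge0// boosted_ge0.
  rewrite lee_fin [leRHS]addrAC lerD2r.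
  apply: le_trans (boosted_le al1 ka1 _ _) _; rewrite size_tuple.
  apply: le_trans (_ : ka * al ^+ k.+1 * e.+1%:R <= _)%R; last by rewrite lerDr.
  by rewrite ler_peMr// ler1n.
by rewrite dis0 mul0r !mulr0 addr0.
Qed.

(** The contraction for one iteration. The non-reference particles are drawn equal at time 1, so at
    most the reference pair is discrepant, and only if the paths differ at their first coordinate;
    the two cases call for the two preceding bounds. *)
Lemma ccbpf_steps_le l k (s : k.+1.-tuple X * k.+1.-tuple X) : k.+1 = T ->
  ccbpf_steps mu m C n s (fun p => (potential al p.1 p.2)%:E) <=
  (ka * al ^+ (uncoupled s.1 s.2).+1 * loss l 1)%:E.
Proof.
move=> kT; rewrite /ccbpf_steps /forward_init bindA {1}/bind.
have A0 : (0 <= ka * al ^+ (uncoupled s.1 s.2).+1 * loss l 1)%R.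
  by rewrite mulr_ge0 ?loss_ge0// mulr_ge0 ?exprn_ge0 ?ltW.
apply: (supported_indep (A := fun=> [set z : X * X | z.1 = z.2])) => //.
- by move=> _; exact: superlinear_coupled_init.
- by move=> _; exact: supported_coupled_init.
- move=> Zs; apply: (law_ge0 (superlinear_forward_backward _ _ _ _ _)) => //.
    exact: bounded_init_weights.
  by move=> p; rewrite lee_fin potential_ge0.
move=> Zs /= Zse; rewrite /bind /ret /=; set Z := [tuple of _ :: Zs].
have omb := bounded_init_weights Z.
apply: le_trans (_ : forward_backward mu m C 1
  ([tuple of behead s.1], [tuple of behead s.2]) Z (init_weights m Z)
  (fun p => (bst p.1 p.2 + 0)%:E) <= _).
  apply: (law_mono (superlinear_forward_backward _ _ _ _ _)) => // p.
    by rewrite lee_fin potential_ge0.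
  by rewrite lee_fin addr0 potential_le_boosted.
have dis : (discrepancy Z (init_weights m Z) <= ~~ (thead s.1 == thead s.2))%N.
  rewrite /discrepancy big_ord_recl [X in (_ + X)%N]big1 ?addn0.
    rewrite /agree tnth_mktuple tnth0 /=.
    by case: eqP => //= ->; rewrite eqxx.
  by move=> i _; rewrite /agree tnth_mktuple tnthS (Zse i) !eqxx.
have [ss|ss] := eqVneq (thead s.1) (thead s.2).
  apply: le_trans (forward_backward_coupled_le l _ (leqnn 1) kT omb (lexx 0%R) _) _ => //.
    by apply/eqP; rewrite -leqn0 (leq_trans dis)// ss eqxx.
  rewrite lee_fin addr0 (_ : uncoupled s.1 s.2 = uncoupled (behead s.1) (behead s.2))//.
  case: s ss {A0 Z omb dis} => p p'; case/tupleP: p => y s; case/tupleP: p' => y' s' /=.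
  by rewrite !theadE => ->; rewrite eqxx.
apply: le_trans (forward_backward_le l _ _ (leqnn 1) kT omb (lexx 0%R)) _ => //.
rewrite lee_fin addr0 (_ : uncoupled s.1 s.2 = k.+1).
  rewrite ler_pM ?loss_ge0// ?mulr_ge0 ?exprn_ge0 ?(ltW al0) ?(ltW ka0)//.
    by rewrite ler_pM2l// ler_weXn2l.
  by rewrite loss_le// (_ : 1 = 1%:R)%R// ler_nat (leq_trans dis) ?leq_b1.
case: s ss {A0 Z omb dis} => p p'; case/tupleP: p => y s; case/tupleP: p' => y' s' /=.
by rewrite !theadE => /negbTE->; rewrite size_tuple.
Qed.

End ccbpf_step.

(** * Real bounds from the strong mixing assumption *)

Section mixing.
Context {R : realType}.

Lemma infE_le (Y : Type) (f : Y -> R) (y0 : Y) : 0 < infE f ->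
  (0 < fine (infE f))%R /\ forall y, (fine (infE f) <= f y)%R.
Proof.
move=> i0; have le y : infE f <= (f y)%:E by apply: ereal_inf_lbound; exists y.
have ifin : infE f \is a fin_num.
  by rewrite ge0_fin_numE ?ltW//; apply: le_lt_trans (le y0) (ltry _).
split=> [|y]; first by rewrite fine_gt0// i0 -ge0_fin_numE ?ltW.
by rewrite -lee_fin fineK.
Qed.

Lemma supE_ge (Y : Type) (f : Y -> R) : supE f < +oo ->
  forall y, (f y <= fine (supE f))%R.
Proof.
move=> sy y; have le : (f y)%:E <= supE f by apply: ereal_sup_ubound; exists y.
rewrite -lee_fin fineK// fin_numE; apply/andP; split; last by rewrite lt_eqF.
by rewrite gt_eqF// (lt_le_trans _ le)// ltNyr.
Qed.

Lemma mixing_const_le d (X : measurableType d) (m : model R X) T t :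
  (1 <= t < T)%N -> (mixing_const T m <= mixing_ratio m t)%R.
Proof.
case/andP=> t1 tT; rewrite /mixing_const gtn_eqF ?(leq_ltn_trans t1)//.
(* The ratio at [t = 1] is the initial value of the minimum, the others are its terms. *)
case: t t1 tT => [|[|t]]// _ tT; first exact: bigmin_le_id.
have tin : t.+2 \in index_iota 2 T by rewrite mem_index_iota.
exact: (ge_bigmin_seq _ _ xpredT (mixing_ratio m) tin).
Qed.

(** The point to prove is [eps_G]: in the product inequality for two consecutive times, the unwanted
    lower bounds are replaced by upper bounds and cancelled. The pair [(t, t.+1)] serves for
    [t < T]. *)
Lemma strong_mixing_bounds d (X : measurableType d) (m : model R X) (T : nat)
    (eps : R) : (0 < eps)%R -> (1 <= T)%N -> strong_mixing T m ->
  (eps <= mixing_const T m)%R ->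
  mixing_bounds eps T m (fun t => fine (Glow m t)) (fun t => fine (Gup m t))
    (fun t => fine (Mlow m t)) (fun t => fine (Mup m t)).
Proof.
move=> e0 T1 [mG mM] eT; pose z0 := (point : X, point : X).
have G0 t : (1 <= t <= T)%N -> (0 < fine (Glow m t))%R.
  move=> /mG[]; rewrite /Glow; case: ifP => _.
    by move=> /(infE_le point)[].
  by move=> /(infE_le z0)[].
have M0 t : (2 <= t <= T)%N -> (0 < fine (Mlow m t))%R.
  by move=> /mM[] /(infE_le z0)[].
have G1b x : (fine (Glow m 1) <= G1 m x <= fine (Gup m 1))%R.
  have [] := mG 1%N; first by rewrite T1.
  by rewrite /Glow /Gup /= => /(infE_le point)[_ ->] /supE_ge->.
have Gtb t : (2 <= t <= T)%N ->
    forall x y, (fine (Glow m t) <= Gt m t x y <= fine (Gup m t))%R.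
  case: t => [|[|t]]// tT x y; have [] := mG t.+2; first by case/andP: tT.
  by rewrite /Glow /Gup /= => /(infE_le z0)[_ /(_ (x, y))->] /supE_ge/(_ (x, y))->.
have Mtb t : (2 <= t <= T)%N ->
    forall x y, (fine (Mlow m t) <= Mt m t x y <= fine (Mup m t))%R.
  move=> /mM[] /(infE_le z0)[_ l] /supE_ge u x y.
  by rewrite (l (x, y)) (u (x, y)).
have Glu t : (1 <= t <= T)%N -> (fine (Glow m t) <= fine (Gup m t))%R.
  case: t => [|[|t]]// tT; first by case/andP: (G1b point) => /le_trans h /h.
  by case/andP: (Gtb t.+2 tT point point) => /le_trans h /h.
have Mlu t : (2 <= t <= T)%N -> (fine (Mlow m t) <= fine (Mup m t))%R.
  by move=> tT; case/andP: (Mtb t tT point point) => /le_trans h /h.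
have ratio t : (1 <= t < T)%N ->
    (eps * (fine (Gup m t) * fine (Mup m t.+1) * fine (Gup m t.+1)) <=
     fine (Glow m t) * fine (Mlow m t.+1) * fine (Glow m t.+1))%R.
  move=> tT; have := le_trans eT (mixing_const_le m tT).
  case/andP: tT => t1 tT; rewrite /mixing_ratio ler_pdivlMr//.
  have t2 : (1 < t.+1 <= T)%N by rewrite ltnS t1.
  have t3 : (1 <= t <= T)%N by rewrite t1 ltnW.
  have t4 : (1 <= t.+1 <= T)%N by rewrite tT.
  rewrite !mulr_gt0//.
  - exact: lt_le_trans (G0 _ t3) (Glu _ t3).
  - exact: lt_le_trans (M0 _ t2) (Mlu _ t2).
  - exact: lt_le_trans (G0 _ t4) (Glu _ t4).
split=> // t /andP[t1 tT].
have [t_T|] := ltnP t T.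
  have t2 : (1 < t.+1 <= T)%N by rewrite ltnS t1.
  have t3 : (1 <= t <= T)%N by rewrite t1 tT.
  have t4 : (1 <= t.+1 <= T)%N by rewrite t_T.
  have r : (1 <= t < T)%N by rewrite t1.
  have := ratio t r.
  have := G0 _ t4; have := Glu _ t4; have := M0 _ t2; have := Mlu _ t2.
  have := G0 _ t3.
  set g := fine (Glow m t); set g' := fine (Glow m t.+1).
  set u := fine (Gup m t); set u' := fine (Gup m t.+1).
  set a := fine (Mlow m _); set b := fine (Mup m _).
  move=> g0 ab a0 gu' g'0 rat.
  have b0 := lt_le_trans a0 ab; have u'0 := lt_le_trans g'0 gu'.
  rewrite -(ler_pM2r (mulr_gt0 b0 u'0)) -mulrA [(u * _)%R]mulrA.
  apply: le_trans rat _; rewrite -mulrA ler_pM2l//.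
  by apply: ler_pM => //; exact: ltW.
move=> Tt; have {Tt}tE : t = T by apply/eqP; rewrite eqn_leq tT.
(* At the last time the pair formed with the preceding time is used, except for [T = 1], where the
   inequality is the definition of the mixing constant. *)
subst t; move: eT; case: (T) T1 G0 Glu M0 Mlu ratio => [//|[|t]] _ G0 Glu M0 Mlu ratio.
  by rewrite /mixing_const/= ler_pdivlMr// (lt_le_trans (G0 _ _) (Glu _ _)).
move=> _; have r : (1 <= t.+1 < t.+2)%N by rewrite ltnS leqnn.
have t2 : (1 < t.+2 <= t.+2)%N by rewrite leqnn.
have t3 : (1 <= t.+1 <= t.+2)%N by rewrite leqnSn.
have t4 : (1 <= t.+2 <= t.+2)%N by rewrite leqnn.
have := ratio _ r.
have := G0 _ t3; have := Glu _ t3; have := M0 _ t2; have := Mlu _ t2.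
have := G0 _ t4.
set g' := fine (Glow m t.+2); set g := fine (Glow m t.+1).
set u' := fine (Gup m t.+2); set u := fine (Gup m t.+1).
set a := fine (Mlow m _); set b := fine (Mup m _).
move=> g'0 ab a0 gu g0 rat.
have b0 := lt_le_trans a0 ab; have u0 := lt_le_trans g0 gu.
rewrite -(ler_pM2l (mulr_gt0 u0 b0)) mulrCA.
apply: le_trans rat _; rewrite ler_pM2r//.
by apply: ler_pM => //; exact: ltW.
Qed.

End mixing.

(** * Measurability of the uncoupled length *)

Section measurability.
Context d (X : measurableType d).
Hypothesis mdiag : measurable_diagonal X.

(** This turns the sublevel sets of [uncoupled] into intersections of coordinatewise equalities,
    which are measurable because the diagonal is. *)
Lemma uncoupled_leP (Y : eqType) (y0 : Y) (s s' : seq Y) j : size s = size s' ->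
  (uncoupled s s' <= j)%N <->
  (forall i, (i + j < size s)%N -> nth y0 s i = nth y0 s' i).
Proof.
elim: s s' => [|x s IH] [|x' s']//= [/IH{}IH].
case: eqP => [->|xx'].
  split=> [/IH h [|i]//|h]; first by rewrite addSn ltnS => /h.
  by apply/IH => i ij; apply: (h i.+1); rewrite addSn ltnS.
split=> [sj i|h]; first by rewrite ltnNge (leq_trans sj)// leq_addl.
by rewrite leqNgt; apply/negP => js; apply/xx'/(h 0%N).
Qed.

Lemma measurable_eq_tnth T (i : 'I_T) :
  measurable [set p : T.-tuple X * T.-tuple X | tnth p.1 i = tnth p.2 i].
Proof.
have mf : measurable_fun setT
    (fun p : T.-tuple X * T.-tuple X => (tnth p.1 i, tnth p.2 i)).
  apply/measurable_fun_pair => /=.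
    exact: (measurableT_comp (measurable_tnth i) measurable_fst).
  exact: (measurableT_comp (measurable_tnth i) measurable_snd).
have := mf measurableT _ mdiag; congr measurable.
by apply/seteqP; split=> p //= [].
Qed.

Lemma measurable_uncoupled_le T j :
  measurable [set p : T.-tuple X * T.-tuple X | (uncoupled p.1 p.2 <= j)%N].
Proof.
rewrite (_ : [set _ | _] = \bigcap_(i in [set i | (i + j < T)%N])
  [set p : T.-tuple X * T.-tuple X | nth point p.1 i = nth point p.2 i]).
  apply: bigcap_measurableType => i /= ij.
  have iT : (i < T)%N by rewrite (leq_ltn_trans (leq_addr j i)).
  have := measurable_eq_tnth (Ordinal iT); congr measurable.
  by apply/seteqP; split=> p /=; rewrite !(tnth_nth point).
have E (p : T.-tuple X * T.-tuple X) := @uncoupled_leP _ point p.1 p.2 j.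
apply/seteqP; split=> p /= h.
  by move=> i /= ij; apply: (iffLR (E p _) h); rewrite !size_tuple.
by apply/E; rewrite !size_tuple// => i ij; exact: h.
Qed.

Lemma measurable_uncoupled_eq T j :
  measurable [set p : T.-tuple X * T.-tuple X | uncoupled p.1 p.2 = j].
Proof.
case: j => [|j].
  rewrite (_ : [set _ | _] =
    [set p : T.-tuple X * T.-tuple X | (uncoupled p.1 p.2 <= 0)%N]).
    exact: measurable_uncoupled_le.
  by apply/seteqP; split=> p /=; rewrite leqn0 => /eqP.
rewrite (_ : [set _ | _] =
  [set p : T.-tuple X * T.-tuple X | (uncoupled p.1 p.2 <= j.+1)%N] `\`
  [set p : T.-tuple X * T.-tuple X | (uncoupled p.1 p.2 <= j)%N]).
  by apply: measurableD; exact: measurable_uncoupled_le.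
apply/seteqP; split=> p /=; first by move=> ->; rewrite ltnn; split.
by move=> [le1 /negP]; rewrite -ltnNge => le2; apply/eqP; rewrite eqn_leq le1.
Qed.

Lemma tuple_neq_uncoupled T (p : T.-tuple X * T.-tuple X) :
  p.1 <> p.2 <-> uncoupled p.1 p.2 <> 0%N.
Proof.
have := @uncoupled_eq0 _ p.1 p.2; rewrite !size_tuple => /(_ erefl) e.
split=> [pp /eqP|pp ee]; first by rewrite e => /eqP/val_inj.
by apply: pp; apply/eqP; rewrite e ee.
Qed.

Lemma measurable_tuple_neq T : measurable [set p : T.-tuple X * T.-tuple X | p.1 <> p.2].
Proof.
rewrite (_ : [set _ | _] =
  ~` [set p : T.-tuple X * T.-tuple X | uncoupled p.1 p.2 = 0%N]).
  by apply: measurableC; exact: measurable_uncoupled_eq.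
by apply/seteqP; split=> p /tuple_neq_uncoupled.
Qed.

End measurability.

(** * Tail of the coupling time *)

Section coupled_chain.
Context {R : realType} d (X : measurableType d) (T : nat).
Context dW (W : measurableType dW) (P : probability W R).
Let E := (T.-tuple X * T.-tuple X)%type.
Variables (K : E -> @law R E) (s0 : E) (S : nat -> W -> E).
Variables (al th : R).
Hypothesis mdiag : measurable_diagonal X.
Hypothesis al1 : (1 <= al)%R.
Hypothesis th0 : (0 <= th)%R.
Hypothesis slK : forall s, superlinear_law (K s).
Hypothesis K_potential : forall s,
  K s (fun p => (potential al p.1 p.2)%:E) <= (th * al ^+ uncoupled s.1 s.2)%:E.
Hypothesis chain : is_markov_chain P K s0 S.

Definition uncoupled_until k : set W :=
  [set w | forall i, (1 <= i <= k)%N -> (S i w).1 <> (S i w).2].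

(** Only the times 1 to [n - 1] matter. For [n = 0] and [n = 1] the event is certain, in accordance
    with [n.-1 = 0]. *)
Lemma coupling_time_ge n :
  [set w | (n%:R : R)%:E <= coupling_time R S w] = uncoupled_until n.-1.
Proof.
apply/seteqP; split=> w /=.
  move=> nt i /andP[i1 i_n] Si.
  suff : (n%:R : R)%:E <= i%:R%:E.
    rewrite lee_fin ler_nat => n_i; 
    case: (n) n_i i_n => [|n'] /= n_i i_n; first by move: i_n; rewrite leqNgt i1.
    by have := leq_trans n_i i_n; rewrite ltnn.
  by apply: le_trans nt _; apply: ereal_inf_lbound; exists i.
move=> h; apply: le_ereal_inf_tmp => _ [i [i1 Si] <-]; rewrite lee_fin ler_nat.
rewrite leqNgt; apply/negP => i_n; apply: (h i) => //; rewrite i1/=.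
by case: (n) i_n.
Qed.

(** The same event as a set of trajectories, the form in which the Markov property is stated. *)
Let history k : set (k.+1.-tuple E) :=
  [set t | forall i : 'I_k.+1, (0 < i)%N -> (tnth t i).1 <> (tnth t i).2].
Arguments history : clear implicits.

Let measurable_history k : measurable (history k).
Proof.
rewrite (_ : history k = \bigcap_(i in [set: 'I_k.+1])
  [set t | (0 < i)%N -> (tnth t i).1 <> (tnth t i).2]); last first.
  by apply/seteqP; split=> t /= h i => [_|]; exact: h.
apply: fin_bigcap_measurable => [|i _]; first exact: finite_finset.
case: (posnP i) => i0.
  rewrite (_ : [set _ | _] = setT)//; apply/seteqP; split=> t //= _.
rewrite (_ : [set _ | _] =
  setT `&` (fun t : k.+1.-tuple E => tnth t i) @^-1` [set p | p.1 <> p.2]).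
  by apply: (measurable_tnth i) => //; exact: measurable_tuple_neq.
by apply/seteqP; split=> t /=; [move=> /(_ isT)|case=> _ h _].
Qed.

Let uncoupled_untilE k :
  uncoupled_until k = [set w | history k [tuple S i w | i < k.+1]].
Proof.
apply/seteqP; split=> w /= h.
  by move=> i i0; rewrite tnth_mktuple; apply: h; rewrite i0 -ltnS ltn_ord.
move=> i /andP[i1 ik]; have := h (Ordinal (ik : (i < k.+1)%N)) i1.
by rewrite tnth_mktuple.
Qed.

Let measurable_preimage k (B : set E) : measurable B -> measurable (S k @^-1` B).
Proof.
move=> mB; rewrite -[X in measurable X]setTI.
exact: (chain_measurable chain k).
Qed.

Lemma measurable_uncoupled_until k : measurable (uncoupled_until k).
Proof.
rewrite (_ : uncoupled_until k = \bigcap_(i in [set i | (1 <= i <= k)%N])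
  (S i @^-1` [set p | p.1 <> p.2])).
  apply: bigcap_measurableType => i _.
  by apply: measurable_preimage; exact: measurable_tuple_neq.
by apply/seteqP; split=> w.
Qed.

Let level j : set E := [set p : E | uncoupled p.1 p.2 = j].
Let weight j : R := if j == 0%N then 0%R else (al ^+ j)%R.

Let weight_ge0 j : (0 <= weight j)%R.
Proof. by rewrite /weight; case: ifP => // _; rewrite exprn_ge0// (le_trans ler01). Qed.

(** The Markov property is available for indicators only; as the potential takes finitely many
    values, it is a finite combination of them. *)
Let potential_levels (p : E) : (potential al p.1 p.2)%:E =
  \sum_(j < T.+1) (weight j)%:E * (\1_(level j) p)%:E.
Proof.
have lt : (uncoupled p.1 p.2 < T.+1)%N.
  by rewrite ltnS (leq_trans (uncoupled_size _ _))// size_tuple.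
rewrite (bigD1 (Ordinal lt))//= big1 ?adde0.
  by rewrite indicE mem_set// mule1.
move=> j /eqP jp; rewrite indicE memNset ?mule0// => /= /esym e.
by apply: jp; apply/val_inj.
Qed.

Let measurable_potential k : measurable_fun setT
  (fun w => (potential al (S k w).1 (S k w).2)%:E).
Proof.
under eq_fun do rewrite potential_levels.
apply: emeasurable_sum => j; apply: emeasurable_funM => //.
apply/measurable_EFinP.
rewrite (_ : (fun w => _) = \1_(S k @^-1` level j)) //.
by apply: measurable_indic; apply: measurable_preimage; exact: measurable_uncoupled_eq.
Qed.

Definition energy k : \bar R :=
  \int[P]_(w in uncoupled_until k) (potential al (S k w).1 (S k w).2)%:E.

(** The condition at time [k.+1] is dropped, the Markov property is applied to each level set, and
    the levels are recombined by superlinearity, first under [P] and then under [K]. Both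
    recombinations go in the direction needed. *)
Lemma energyS k : energy k.+1 <=
  \int[P]_(w in uncoupled_until k) (th * al ^+ uncoupled (S k w).1 (S k w).2)%:E.
Proof.
have pot0 (p : E) : 0 <= (potential al p.1 p.2)%:E by rewrite lee_fin potential_ge0.
apply: le_trans (_ : \int[P]_(w in uncoupled_until k)
    (potential al (S k.+1 w).1 (S k.+1 w).2)%:E <= _).
  apply: ge0_subset_integral => //; try exact: measurable_uncoupled_until.
    exact: measurable_funS (measurable_potential k.+1).
  by move=> w h i /andP[i1 ik]; apply: h; rewrite i1 ltnW.
under eq_integral do rewrite potential_levels.
rewrite ge0_integral_sum//; last 3 first.
- exact: measurable_uncoupled_until.
- move=> j; apply: emeasurable_funM => //; apply/measurable_EFinP.
  rewrite (_ : (fun w => _) = \1_(S k.+1 @^-1` level j)) //.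
  by apply: measurable_indic; apply: measurable_preimage; exact: measurable_uncoupled_eq.
- by move=> j w _; rewrite mule_ge0// lee_fin.
have step (j : 'I_T.+1) : \int[P]_(w in uncoupled_until k)
    ((weight j)%:E * (\1_(level j) (S k.+1 w))%:E) =
    (weight j)%:E * \int[P]_(w in uncoupled_until k)
      K (S k w) (fun z => (\1_(level j) z)%:E).
  rewrite ge0_integralZl_EFin//; last 2 first.
  - exact: measurable_uncoupled_until.
  - apply/measurable_EFinP.
    rewrite (_ : (fun w => _) = \1_(S k.+1 @^-1` level j)) //.
    by apply: measurable_indic; apply: measurable_preimage; exact: measurable_uncoupled_eq.
  congr (_ * _).
  transitivity (\int[P]_(w in uncoupled_until k) (\1_(S k.+1 @^-1` level j) w)%:E) => //.
  rewrite integral_indic; last 2 first.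
  - exact: measurable_uncoupled_until.
  - by apply: measurable_preimage; exact: measurable_uncoupled_eq.
  rewrite setIC uncoupled_untilE.
  by apply: (chain_transition chain) => //; exact: measurable_uncoupled_eq.
under eq_bigr do rewrite step.
apply: le_trans (law_superlinear_sum (superlinear_integral P (uncoupled_until k))
  (fun j => weight_ge0 j) (f := fun (j : 'I_T.+1) w =>
    K (S k w) (fun z => (\1_(level j) z)%:E)) _) _.
  by move=> j w; apply: (law_ge0 (slK _)) => z; rewrite lee_fin.
apply: integral_mono => w _.
  apply: sume_ge0 => j _; rewrite mule_ge0 ?lee_fin//.
  by apply: (law_ge0 (slK _)) => z; rewrite lee_fin.
apply: le_trans (K_potential (S k w)).
apply: le_trans (law_superlinear_sum (slK (S k w)) (fun j => weight_ge0 j)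
  (f := fun (j : 'I_T.+1) z => (\1_(level j) z)%:E) _) _.
  by move=> j z; rewrite lee_fin.
apply: (law_mono (slK _)) => z; last by rewrite potential_levels.
by apply: sume_ge0 => j _; rewrite mule_ge0 ?lee_fin.
Qed.

Lemma energy_le k : energy k.+1 <= (th ^+ k.+1 * al ^+ T)%:E.
Proof.
elim: k => [|k IH]; apply: le_trans (energyS _) _.
  (* The initial references may coincide, in which case [al ^+ 0 = 1] is not their potential; the
     first step therefore uses the bound [D <= T]. *)
  rewrite (_ : uncoupled_until 0 = setT); last first.
    by apply/seteqP; split=> w // _ i /andP[i1]; rewrite leqNgt i1.
  apply: le_trans (_ : \int[P]_w (th * al ^+ T)%:E <= _); last first.
    by rewrite integral_cst// [X in _ * X]probability_setT mule1 expr1.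
  apply: integral_mono => w _.
    by rewrite lee_fin mulr_ge0// exprn_ge0// (le_trans ler01).
  rewrite lee_fin ler_wpM2l// ler_weXn2l//.
  by rewrite (leq_trans (uncoupled_size _ _))// size_tuple.
rewrite exprS -mulrA EFinM; apply: le_trans (lee_wpmul2l _ IH); last by rewrite lee_fin.
rewrite -ge0_integralZl_EFin//; last 3 first.
- exact: measurable_uncoupled_until.
- by move=> w _; rewrite lee_fin potential_ge0.
- exact: measurable_funS (measurable_potential k.+1).
(* On the domain of integration the current paths differ, so [al ^+ D] is the potential and the
   recursion closes. *)
rewrite le_eqVlt; apply/orP; left; apply/eqP/eq_integral => w.
rewrite inE => /(_ k.+1); rewrite leqnn => /(_ isT)/tuple_neq_uncoupled/eqP.
by rewrite -EFinM /potential => /negbTE->.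
Qed.

(** Markov's inequality: the potential is at least 1 wherever the paths differ. *)
Lemma uncoupled_until_le k :
  P (uncoupled_until k.+1) <= (th ^+ k.+1 * al ^+ T)%:E.
Proof.
apply: le_trans (energy_le k).
have mU := measurable_uncoupled_until k.+1.
rewrite -[leLHS]mul1e -(integral_cst P mU).
apply: integral_mono => // w h; rewrite lee_fin /potential.
have /tuple_neq_uncoupled/eqP/negbTE-> := h k.+1 (leqnn _).
exact: exprn_ege1.
Qed.

End coupled_chain.

(** * Choice of the constants and the tail bound *)

Lemma coupling_constants (R : realType) (eps alpha beta : R) :
  (0 < eps <= 1)%R -> (1 < alpha)%R -> (1 < beta)%R ->
  exists al ka : R, exists l N0 : nat,
  [/\ (1 <= al <= alpha)%R, (1 <= ka)%R, (eps + (1 - eps) * al * ka <= ka)%R &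
    forall n, (N0 <= n.+1)%N ->
      (0 <= ka * al * loss eps n al l 1 <= beta ^- 2)%R].
Proof.
move=> /andP[e0 e1] a1 b1; pose al := Num.min alpha (1 + eps)%R.
have al1 : (1 < al)%R by rewrite /al lt_min a1 ltrDl.
have ale : (al <= 1 + eps)%R by rewrite /al ge_min lexx orbT.
(* Since [al <= 1 + eps], the product [(1 - eps) * al] is at most [1 - eps * eps]. *)
have q0 : (0 < 1 - (1 - eps) * al)%R.
  have := mulr_gt0 e0 e0; nra.
(* This solves [ka = 1 + (1 - eps) * al * ka], and [eps <= 1] then gives the condition on [ka]. *)
pose ka := (1 - (1 - eps) * al)^-1%R.
have ka1 : (1 <= ka)%R by rewrite invf_ge1// gerBl mulr_ge0 ?subr_ge0//; lra.
have kaE : (ka - (1 - eps) * al * ka = 1)%R.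
  by rewrite -{1}[ka]mul1r -mulrBl mulfV// gt_eqF.
have al0 : (0 < al)%R by exact: lt_trans al1.
have ka0 : (0 < ka)%R by exact: lt_le_trans ka1.
(* [del] is half of the admissible loss: one half is for [al ^- l], which fixes [l], the other for
   the term of order [1 / N], which then fixes [N0]. *)
pose del := (beta ^- 2 / (2 * (ka * al)))%R.
have del0 : (0 < del)%R.
  by rewrite divr_gt0 ?invr_gt0 ?exprn_gt0 ?mulr_gt0// (lt_trans _ b1).
have [l ll] : exists l, (al ^- l < del)%R.
  have c : (al^-1 ^+ n)%R @[n --> \oo] --> (0 : R)%R.
    by apply: cvg_expr; rewrite ger0_norm ?invr_ge0 ?(ltW al0)// invf_lt1.
  have [l _ h] := cvgr_lt _ c _ del0; exists l.
  by rewrite -exprVn; exact: (h l (leqnn _)).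
have s0 : (0 <= slope eps l + drift eps l)%R.
  by rewrite addr_ge0 ?slope_ge0 ?drift_ge0// e0.
exists al, ka, l, (Num.bound ((slope eps l + drift eps l) / del)%R).+1; split=> //.
- by rewrite (ltW al1) /al ge_min lexx.
- lra.
move=> n Nn; have N0 : (0 < n.+1%:R :> R)%R by rewrite ltr0n.
apply/andP; split.
  apply: mulr_ge0; first by rewrite ltW// mulr_gt0.
  by apply: loss_ge0; rewrite ?e0 ?(ltW al1).
have h2 : ((slope eps l + drift eps l) / n.+1%:R <= del)%R.
  rewrite ler_pdivrMr// mulrC -ler_pdivrMr//.
  apply: le_trans (ltW (archi_boundP _)) _; first by rewrite divr_ge0// ltW.
  by rewrite ler_nat ltnW.
rewrite /loss mulr1.
apply: le_trans (_ : ka * al * (del + del) <= _)%R.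
  by rewrite ler_pM2l ?mulr_gt0// lerD// ltW.
by rewrite le_eqVlt; apply/orP; left; apply/eqP; rewrite /del; field; rewrite !gt_eqF// (lt_trans _ b1).
Qed.

(** The event for [n] involves [n - 1] iterations, each with factor at most [beta ^- 2], and
    [2 (n - 1) >= n] once [n >= 2]. For [n = 0] the right-hand side is at least 1. For [n = 1] the
    event is certain while [alpha ^+ T / beta] may be less than 1. *)
Lemma coupling_time_tail (R : realType) (eps alpha beta : R) :
  (0 < eps <= 1)%R -> (1 < alpha)%R -> (1 < beta)%R ->
  exists N0 : nat, forall N : nat, (2 <= N)%N -> (N0 <= N)%N ->
  forall (d : measure_display) (X : measurableType d)
    (mu : {sigma_finite_measure set X -> \bar R})
    (T : nat) (m : model R X) (C : couplings R X)
    (s : T.-tuple X * T.-tuple X)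
    (dW : measure_display) (W : measurableType dW) (P : probability W R)
    (S : nat -> W -> T.-tuple X * T.-tuple X),
  measurable_diagonal X -> (1 <= T)%N -> admissible mu eps T m C ->
  is_markov_chain P (@ccbpf R d X mu m C N T) s S ->
  forall n : nat, n != 1%N ->
    P [set w | (n%:R : R)%:E <= coupling_time R S w]
      <= (alpha ^+ T * beta ^- n)%:E.
Proof.
move=> eps01 a1 b1; have e0 : (0 < eps)%R by case/andP: eps01.
have [al [ka [l [N0 [/andP[al1 ala] ka1 kaal hN]]]]] := coupling_constants eps01 a1 b1.
exists N0 => N N2 N0N d X mu T m C s dW W P S mdiag T1 [mP sm eT _] chain n n1.
have mB := strong_mixing_bounds e0 T1 sm eT.
rewrite coupling_time_ge.
have a0 : (0 <= alpha)%R by exact: le_trans (ltW a1).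
have b0 : (0 < beta)%R by exact: lt_trans b1.
case: n n1 => [_|[//|n] _] /=.
  rewrite expr0 invr1 mulr1; apply: le_trans (probability_le1 _ _) _.
    exact: (measurable_uncoupled_until mdiag chain).
  by rewrite lee_fin exprn_ege1// ltW.
pose th := (ka * al * loss eps N.-1 al l 1)%R.
have /andP[th0 thb] : (0 <= th <= beta ^- 2)%R.
  by apply: hN; rewrite prednK// (leq_trans _ N2).
case: T s m C S T1 mP sm eT chain mB => [//|T] s m C S T1 mP sm eT chain mB.
apply: le_trans (uncoupled_until_le mdiag al1 th0 _ _ chain n) _.
- by move=> s1; exact: (superlinear_ccbpf_steps C mP mB).
- move=> s1; apply: le_trans (ccbpf_steps_le C eps01 mP mB _ al1 ka1 kaal l s1 erefl) _.
  rewrite lee_fin le_eqVlt; apply/orP; left; apply/eqP.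
  by rewrite /th exprS; ring.
rewrite lee_fin mulrC ler_pM ?exprn_ge0// ?(le_trans ler01)//.
  by rewrite ler_pXn2r// ?nnegrE// (le_trans ler01).
apply: le_trans (_ : (beta ^- 2) ^+ n.+1 <= _)%R.
  by rewrite ler_pXn2r// nnegrE// invr_ge0 exprn_ge0// ltW.
rewrite exprVn -exprM lef_pV2 ?posrE ?exprn_gt0//.
by rewrite ler_weXn2l ?(ltW b1)//; lia.
Qed.

(** * The limit of large horizons *)

Lemma couples_in_linear_time_of_tail (R : realType) (eps alpha beta rho : R)
    (N : nat) : (1 < alpha)%R -> (1 < beta)%R -> (ln alpha / ln beta < rho)%R ->
  (forall (d : measure_display) (X : measurableType d)
    (mu : {sigma_finite_measure set X -> \bar R})
    (T : nat) (m : model R X) (C : couplings R X)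
    (s : T.-tuple X * T.-tuple X)
    (dW : measure_display) (W : measurableType dW) (P : probability W R)
    (S : nat -> W -> T.-tuple X * T.-tuple X),
  measurable_diagonal X -> (1 <= T)%N -> admissible mu eps T m C ->
  is_markov_chain P (@ccbpf R d X mu m C N T) s S ->
  forall n : nat, n != 1%N ->
    P [set w | (n%:R : R)%:E <= coupling_time R S w]
      <= (alpha ^+ T * beta ^- n)%:E) ->
  couples_in_linear_time eps N rho.
Proof.
move=> a1 b1 rab tail d X mu m C s dW W P S mdiag adm chain.
have a0 : (0 < alpha)%R by exact: lt_trans a1.
have b0 : (0 < beta)%R by exact: lt_trans b1.
have la0 : (0 < ln alpha)%R by rewrite ln_gt0.
have lb0 : (0 < ln beta)%R by rewrite ln_gt0.
have rho0 : (0 < rho)%R by apply: lt_trans rab; rewrite divr_gt0.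
(* With [n >= rho T] the tail bound is at most [(alpha * beta ^ (- rho)) ^ T], and the assumption on
   [rho] says that this base is below 1. *)
pose q := expR (ln alpha - rho * ln beta).
have q1 : (q < 1)%R by rewrite expR_lt1 subr_lt0 -ltr_pdivrMr.
(* The condition [rho T > 1], true for large [T], makes the ceiling at least 2 and so avoids
   [n = 1]. *)
have bound T : (1 <= T)%N -> (1 < rho * T%:R)%R ->
    P T [set w | ((Num.ceil (rho * T%:R))%:~R : R)%:E <= coupling_time R (S T) w]
    <= (q ^+ T)%:E.
  move=> T1 rT; pose n := `|Num.ceil (rho * T%:R)%R|%N.
  have c1 : (1 < Num.ceil (rho * T%:R))%R by rewrite ceil_gt_int.
  have nE : (Num.ceil (rho * T%:R))%:~R = n%:R :> R.
    by rewrite [RHS]pmulrn /n gez0_abs// ltW// (lt_trans _ c1).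
  have n1 : n != 1%N.
    by apply/eqP => n1; have := c1; rewrite -[Num.ceil _]gez0_abs -/n ?n1// ltW// (lt_trans _ c1).
  rewrite nE; apply: le_trans (tail _ _ _ _ _ _ _ _ _ _ _ mdiag T1 (adm T T1) (chain T T1) n n1) _.
  have rn : (rho * T%:R <= n%:R)%R by rewrite -nE ceil_ge.
  rewrite lee_fin -{1}(lnK (a0 : alpha \is Num.pos)) -{1}(lnK (b0 : beta \is Num.pos)).
  rewrite -!expRM_natl -expRN -expRD ler_expR.
  rewrite -mulrN; have := ler_wpM2r (ltW lb0) rn; nra.
apply: (@squeeze_cvge _ _ _ _ (fun=> 0) _ (fun T => (q ^+ T)%:E)).
- near=> T; rewrite measure_ge0/=; apply: bound.
    near: T; exact: nbhs_infty_ge.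
  rewrite mulrC -ltr_pdivrMr//; near: T; exact: nbhs_infty_gtr.
- exact: cvg_cst.
- apply: cvg_EFin; first exact: nearW.
  by apply: cvg_expr; rewrite ger0_norm// expR_ge0.
Unshelve. all: by end_near. Qed.

Theorem theorem6 (R : realType) (eps : R) (heps : (0 < eps <= 1)%R) :
  (forall rho : R, (0 < rho)%R ->
     exists N0 : nat, forall N : nat, (2 <= N)%N -> (N0 <= N)%N ->
       couples_in_linear_time eps N rho)
  /\
  (forall alpha beta : R, (1 < alpha)%R -> (1 < beta)%R ->
     exists N0 : nat, forall N : nat, (2 <= N)%N -> (N0 <= N)%N ->
       (forall (d : measure_display) (X : measurableType d)
          (mu : {sigma_finite_measure set X -> \bar R})
          (T : nat) (m : model R X) (C : couplings R X)
          (s : T.-tuple X * T.-tuple X)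
          (dW : measure_display) (W : measurableType dW) (P : probability W R)
          (S : nat -> W -> T.-tuple X * T.-tuple X),
          measurable_diagonal X -> (1 <= T)%N ->
          admissible mu eps T m C ->
          is_markov_chain P (@ccbpf R d X mu m C N T) s S ->
          forall n : nat, n != 1%N ->
            P [set w | (n%:R : R)%:E <= coupling_time R S w]
              <= (alpha ^+ T * beta ^- n)%:E)
       /\
       (forall rho : R, (ln alpha / ln beta < rho)%R ->
          couples_in_linear_time eps N rho)).
Proof.
split=> [rho rho0|alpha beta a1 b1]; last first.
  have [N0 tail] := coupling_time_tail heps a1 b1.
  exists N0 => N N2 N0N; have {}tail := tail N N2 N0N.
  by split=> // rho ab; exact: couples_in_linear_time_of_tail a1 b1 ab tail.
(* With [alpha = e] and [beta = e ^ (2 / rho)] the threshold [ln alpha / ln beta] is [rho / 2]. *)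
have a1 : (1 < expR 1 :> R)%R by rewrite expR_gt1.
have b1 : (1 < expR (2 / rho) :> R)%R by rewrite expR_gt1 divr_gt0.
have [N0 tail] := coupling_time_tail heps a1 b1.
exists N0 => N N2 N0N; apply: couples_in_linear_time_of_tail a1 b1 _ (tail N N2 N0N).
by rewrite !expRK div1r invf_div ltr_pdivrMr// ltr_pMr// ltr1n.
Qed.
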